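(* Let $\vec G=(V,\vec E)$ be a finite directed graph with no self-edges and no multiple edges whose associated undirected graph $G=(V,E)$ is connected, let $A\in\mathbb{R}^{V\times\vec E}$ be its vertex-edge incidence matrix, and for each $e\in\vec E$ let $f_e:\mathbb{R}\to\mathbb{R}$ be strongly convex and twice continuously differentiable. For $b\in\mathbb{R}^V$ with $\mathbb{1}^Tb=0$ let $x^\star(b)$ be the optimal network flow, let $\Sigma(b),\sigma(b)_e,W(b),d(b)_v,L(b),P(b)$ be as defined in the context, and let $D(b):=\Sigma(b)A^TL(b)^{+}\in\mathbb{R}^{\vec E\times V}$. Then the optimal network flow $x^\star$ is continuously differentiable along $\operatorname{Im}(A)$, and for every differentiable function $\varepsilon\in\mathbb{R}\mapsto b(\varepsilon)\in\operatorname{Im}(A)$, $$\frac{d x^\star(b(\varepsilon))}{d\varepsilon}=D(b(\varepsilon))\,\frac{d b(\varepsilon)}{d\varepsilon}.$$ Moreover, for every $e=(u,v)\in\vec E$, writing $b=b(\varepsilon)$ on the right-hand side, $$\frac{d x^\star(b(\varepsilon))_e}{d\varepsilon}=\sigma(b)_e\sum_{z\in V}\frac{1}{d(b)_z}\frac{d b(\varepsilon)_z}{d\varepsilon}\sum_{t=0}^{\infty}\bigl(P(b)^t_{uz}-P(b)^t_{vz}\bigr).$$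
   Context: The undirected graph $G=(V,E)$ associated with $\vec G$ has $\{u,v\}\in E$ iff $(u,v)\in\vec E$ or $(v,u)\in\vec E$; ''no multiple edges'' is understood to include that at most one of $(u,v),(v,u)$ belongs to $\vec E$. The incidence matrix is $A_{ve}:=1$ if $e$ leaves $v$, $A_{ve}:=-1$ if $e$ enters $v$, and $A_{ve}:=0$ otherwise. $\mathbb{1}$ is the all-ones vector; since $G$ is connected, $\operatorname{Im}(A)=\{y\in\mathbb{R}^V:\mathbb{1}^Ty=0\}$. The optimal network flow is $x^\star(b):=\operatorname{argmin}\{f(x):x\in\mathbb{R}^{\vec E},\ Ax=b\}$ with $f(x):=\sum_{e\in\vec E}f_e(x_e)$ (the minimizer is unique). For $b\in\operatorname{Im}(A)$: $\Sigma(b):=\nabla^2f(x^\star(b))^{-1}\in\mathbb{R}^{\vec E\times\vec E}$, a diagonal matrix with entries $\sigma(b)_e:=\Sigma(b)_{ee}=(f_e''(x^\star(b)_e))^{-1}>0$; $W(b)\in\mathbb{R}^{V\times V}$ is symmetric with $W(b)_{uv}:=\sigma(b)_e$ if $e=(u,v)\in\vec E$ or $e=(v,u)\in\vec E$, and $W(b)_{uv}:=0$ otherwise; $d(b)_v:=\sum_{u\in V}W(b)_{vu}$; $L(b):=\operatorname{diag}(d(b))-W(b)$ (weighted graph Laplacian); $P(b):=\operatorname{diag}(d(b))^{-1}W(b)$ (random walk transition matrix; $P(b)^t$ is its $t$-th power). $M^{+}$ denotes the Moore-Penrose pseudoinverse. ''Continuously differentiable along $\operatorname{Im}(A)$'' means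 $C^1$ as a map on the vector space $\operatorname{Im}(A)$.
   Formalization: The series over t diverges for every edge when G is bipartite (e.g. a single edge), so the last formula is stated with the ordinary infinite sum for non-bipartite G, and with the Cesàro sum of the series for every connected G. *)

(* Defs.v *)
From HB Require Import structures.
From mathcomp Require Import all_boot all_order all_algebra.
From mathcomp Require Import all_classical all_reals all_analysis.
Import Order.TTheory GRing.Theory Num.Theory.
Import numFieldNormedType.Exports.

Set Implicit Arguments.
Unset Strict Implicit.
Unset Printing Implicit Defensive.

Local Open Scope classical_set_scope.
Local Open Scope ring_scope.

(* The directed graph has vertex set 'I_n and edge set 'I_m; the edge e goes
   from src e to tgt e. *)
Section Digraph.
Variables (n m : nat) (src tgt : 'I_m -> 'I_n).

Definition joins (e : 'I_m) (u v : 'I_n) : bool :=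
  ((src e == u) && (tgt e == v)) || ((src e == v) && (tgt e == u)).

(* The second condition excludes parallel edges and antiparallel ones alike. *)
Definition simple_digraph : Prop :=
  (forall e, src e != tgt e) /\
  (forall e e', joins e (src e') (tgt e') -> e = e').

Definition adjacent : rel 'I_n := fun u v => [exists e, joins e u v].

Definition connected_graph : Prop := forall u v, connect adjacent u v.

Definition bipartite_graph : Prop :=
  exists c : 'I_n -> bool, forall e, c (src e) != c (tgt e).

Definition incidence (R : realType) : 'M[R]_(n, m) :=
  \matrix_(v, e) (if src e == v then 1 else if tgt e == v then -1 else 0).

End Digraph.

Section Analysis.
Variable R : realType.

Definition strongly_convex (g : R -> R) : Prop :=
  exists2 mu : R, 0 < mu &
    forall x y t : R, 0 <= t -> t <= 1 ->
      g (t * x + (1 - t) * y) <=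
      t * g x + (1 - t) * g y - mu / 2 * t * (1 - t) * (x - y) ^+ 2.

Definition twice_cont_differentiable (g : R -> R) : Prop :=
  [/\ forall x, derivable g x 1,
      forall x, derivable (derive1 g) x 1 &
      continuous (derive1n 2 g)].

Definition mx_image p q (M : 'M[R]_(p, q)) : set 'cV[R]_p :=
  [set y | exists x : 'cV[R]_q, y = M *m x].

(* f restricted to the linear subspace S is C^1.  Only the action of J b on S
   matters: a continuous family of linear maps S -> R^q extends to a continuous
   family of matrices by precomposing with a projection onto S. *)
Definition C1_along p q (S : set 'cV[R]_p) (f : 'cV[R]_p -> 'cV[R]_q) : Prop :=
  exists J : 'cV[R]_p -> 'M[R]_(q, p),
    (forall b, S b -> forall eps : R, 0 < eps ->
       \forall y \near within S (nbhs b),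
         `|f y - f b - J b *m (y - b)| <= eps * `|y - b|) /\
    {within S, continuous J}.

Definition hessian p (F : 'cV[R]_p -> R) (x : 'cV[R]_p) : 'M[R]_p :=
  \matrix_(i, j) derive (fun y => derive F y (delta_mx j 0)) x (delta_mx i 0).

Definition moore_penrose p q (M : 'M[R]_(p, q)) (X : 'M[R]_(q, p)) : Prop :=
  [/\ M *m X *m M = M, X *m M *m X = X,
      (M *m X)^T = M *m X & (X *m M)^T = X *m M].

(* The matrix X with moore_penrose M X exists and is unique. *)
Definition pinv p q (M : 'M[R]_(p, q)) : 'M[R]_(q, p) :=
  xget 0 [set X | moore_penrose M X].

(* Means of the partial sums u_0 + ... + u_k, for k = 0, 1, 2, and so on; when
   series u converges they have the same limit. *)
Definition cesaro_means (u : R^nat) : R^nat :=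
  arithmetic_mean (fun k => series u k.+1).

End Analysis.

Section NetworkFlow.
Variables (R : realType) (n m : nat) (src tgt : 'I_m -> 'I_n).
Variable f : 'I_m -> R -> R.

Local Notation A := (incidence src tgt R).

Definition total_cost (x : 'cV[R]_m) : R := \sum_e f e (x e 0).

Definition is_optimal_flow (b : 'cV[R]_n) (x : 'cV[R]_m) : Prop :=
  A *m x = b /\ forall y, A *m y = b -> total_cost x <= total_cost y.

(* For strongly convex f e and b in the image of A, the optimal flow exists and
   is unique; the value 0 is only taken for infeasible b. *)
Definition xstar (b : 'cV[R]_n) : 'cV[R]_m :=
  xget 0 [set x | is_optimal_flow b x].

Definition Sigma (b : 'cV[R]_n) : 'M[R]_m :=
  invmx (hessian total_cost (xstar b)).

Definition sigma (b : 'cV[R]_n) (e : 'I_m) : R := Sigma b e e.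

Definition weight (b : 'cV[R]_n) : 'M[R]_n :=
  \matrix_(u, v) (if [pick e | joins src tgt e u v] is Some e
                  then sigma b e else 0).

Definition degree (b : 'cV[R]_n) : 'rV[R]_n := \row_v \sum_u weight b v u.

Definition laplacian (b : 'cV[R]_n) : 'M[R]_n :=
  diag_mx (degree b) - weight b.

Definition transition (b : 'cV[R]_n) : 'M[R]_n :=
  invmx (diag_mx (degree b)) *m weight b.

Definition Dmx (b : 'cV[R]_n) : 'M[R]_(m, n) :=
  Sigma b *m A^T *m pinv (laplacian b).

(* On a bipartite graph the walk has period 2 and the terms of this sequence do
   not tend to 0, so its series diverges and can only be summed in a generalized
   sense, such as the limit of cesaro_means. *)
Definition walk_diff (b : 'cV[R]_n) (e : 'I_m) (z : 'I_n) : R^nat :=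
  fun t => (transition b ^+ t) (src e) z - (transition b ^+ t) (tgt e) z.

End NetworkFlow.

(* Main.v *)
Require Import Defs.
From mathcomp Require Import all_boot all_order all_algebra.
From mathcomp Require Import all_classical all_reals all_analysis.
From mathcomp Require Import ring lra.
Import Order.TTheory GRing.Theory Num.Theory.
Import numFieldNormedType.Exports.

Set Implicit Arguments.
Unset Strict Implicit.
Unset Printing Implicit Defensive.

Local Open Scope classical_set_scope.
Local Open Scope ring_scope.

(** An optimal flow x for b satisfies f_e'(x_e) = p_(src e) - p_(tgt e) for some
potential p, because the gradient of the cost is orthogonal to ker A.  Put
J = Sigma A^T (L + 1 1^T / n)^-1.  Comparing the costs of x(b') and of
x(b) + J (b' - b) gives |x(b') - x(b)| = O(|b' - b|) by strong convexity;
subtracting the two potential equations and linearising f_e' then shows that J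
is the derivative of x along Im A, and there J agrees with Sigma A^T L^+.

For the random walk, (1 - P) X = 1 - 1 pi has a solution X because
L = diag d (1 - P) has range 1^perp.  Hence A^T P^t = A^T P^t X - A^T P^(t+1) X
and the walk series telescopes to A^T X - A^T P^N X.  The energy sum_v d_v y_v^2
decreases along y := P y, by the conditional variances, so the values of P^t y
at two vertices with a common neighbour become equal in the limit; on a connected
nonbipartite graph this reaches all pairs of vertices, so A^T P^N X tends to 0.
In general A^T P^N X telescopes once more, with bounded terms, so that its means
tend to 0. *)

(** * Strongly convex functions of one variable *)

(** Without the division by [y - x] the bound also covers [y = x] and combines directly with norm
    estimates. *)
Lemma is_derive1_nearP (R : realType) (V : normedModType R) (f : R -> V)
    (x : R) (df : V) :
  is_derive x 1 f df <->
  forall e : R, 0 < e ->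
    \forall y \near x, `|f y - f x - (y - x) *: df| <= e * `|y - x|.
Proof.
have shift : (fun h : R => h^-1 *: (f (h *: 1 + x) - f x)) =
             (fun h : R => h^-1 *: (f (h + x) - f x)).
  by apply/funext => h; rewrite [h *: 1]mulr1.
split=> [[+ dfE] e e0|H].
  rewrite /derivable -/(derive f x 1) dfE shift.
  move=> /cvgrPdist_le/(_ _ e0)[/= r r0 H].
  exists r => //= y; rewrite /ball_/= => yr.
  have [->|yx] := eqVneq y x.
   by rewrite !subrr scale0r subr0 !normr0 mulr0.
  have h0 : y - x != 0 by rewrite subr_eq0.
  rewrite distrC in yr; have := H (y - x).
  rewrite /= sub0r normrN => /(_ yr h0) h.
  rewrite -ler_pdivrMr ?normr_gt0//; apply: le_trans _ h.
  rewrite subrK ler_pdivrMr ?normr_gt0// mulrC -normrZ scalerBr scalerA divff//.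
  by rewrite scale1r distrC.
suff cv : (h^-1 *: (f (h *: 1 + x) - f x)) @[h --> 0^'] --> df.
  by apply: DeriveDef; [apply/cvg_ex; exists df|apply: cvg_lim].
rewrite shift; apply/cvgrPdist_le => e e0.
have [r /= r0 {}H] := H _ e0; exists r => //= h.
rewrite /= sub0r normrN => hr h0.
have := H (h + x); rewrite /ball_/= opprD addrCA subrr addr0 normrN addrK.
move=> /(_ hr) {}H.
rewrite -(ler_pM2l (x := `|h|)) ?normr_gt0// -normrZ scalerBr scalerA divff//.
by rewrite scale1r distrC mulrC.
Qed.

Section strong_convexity.
Context {R : realType}.
Implicit Types g : R -> R.

(** The convexity inequality at [t * y + (1 - t) * x], divided by [t], gives the claim as [t] tends
    to 0. *)
Lemma strongly_convex_tangent g : strongly_convex g ->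
  (forall x, derivable g x 1) ->
  exists2 mu : R, 0 < mu &
    forall x y, g x + derive1 g x * (y - x) + mu / 2 * (y - x) ^+ 2 <= g y.
Proof.
move=> [mu mu0 cvx] dg; exists mu => // x y.
have [->|yx] := eqVneq y x; first by rewrite subrr expr0n/= !mulr0 !addr0.
have yx0 : 0 < `|y - x| by rewrite normr_gt0 subr_eq0.
apply/ler_addgt0Pr => e e0.
have := derivableP (dg x); rewrite -derive1E => /is_derive1_nearP.
pose e' := e / 2 / `|y - x|.
have e'0 : 0 < e' by rewrite !divr_gt0.
pose c := mu / 2 * (y - x) ^+ 2.
have c0 : 0 < c by rewrite mulr_gt0 ?divr_gt0// exprn_even_gt0// subr_eq0.
move=> /(_ _ e'0)[r /= r0 H].
(* This [t] keeps the point within [r] of [x] and makes the second-order loss [t * c] at most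
   [e / 2]; the linearisation error, once divided by [t], takes the other half of [e]. *)
pose t := Num.min 1 (Num.min (r / 2 / `|y - x|) (e / 2 / c)).
have t0 : 0 < t by rewrite !lt_min ltr01 !divr_gt0.
have t1 : t <= 1 by rewrite ge_min lexx.
have tr : t * `|y - x| < r.
  rewrite (@le_lt_trans _ _ (r / 2)) ?ltr_pdivrMr ?ltr_pMr ?ltr1n//.
  by rewrite -ler_pdivlMr// !ge_min lexx/= orbT.
have te : t * c <= e / 2 by rewrite -ler_pdivlMr// !ge_min lexx !orbT.
have := H (t * y + (1 - t) * x).
have -> : t * y + (1 - t) * x = x + t * (y - x) by ring.
rewrite /ball_/= opprD addrA subrr add0r normrN normrM (gtr0_norm t0).
rewrite [x + _ - x]addrAC subrr add0r normrM (gtr0_norm t0) => /(_ tr).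
have -> : e' * (t * `|y - x|) = t * (e / 2).
  by rewrite /e'; field; rewrite gt_eqF.
rewrite ler_norml => /andP[+ _].
have := cvx y x t (ltW t0) t1.
have -> : t * y + (1 - t) * x = x + t * (y - x) by ring.
rewrite /GRing.scale/= => h1 h2.
rewrite -(ler_pM2l t0) -/c.
have h3 : t * (t * c) <= t * (e / 2) by rewrite ler_pM2l.
have h4 : mu / 2 * t * (1 - t) * (y - x) ^+ 2 = t * c - t * (t * c).
  by rewrite /c; ring.
move: h1; rewrite h4 => h1; move: h1 h2 h3; lra.
Qed.

(** The mean value theorem yields the slope at some [c] between [x] and [y], and differentiability
    of [derive1 g] at [x] bounds its distance to the slope at [x] by a multiple of [|c - x|]. *)
Lemma taylor1_bound g (x : R) : (forall x, derivable g x 1) ->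
  derivable (derive1 g) x 1 ->
  exists2 M : R, 0 < M & \forall y \near x,
    `|g y - g x - derive1 g x * (y - x)| <= M * (y - x) ^+ 2.
Proof.
move=> dg ddg; have := derivableP ddg; rewrite -derive1E => /is_derive1_nearP.
set s := derive1 (derive1 g) x => /(_ 1 ltr01)[r /= r0 H].
exists (`|s| + 1); first by rewrite ltr_wpDl.
exists r => //= y; rewrite /ball_/= => yr.
have [c cc ->] : exists2 c, `|x - c| <= `|x - y| &
    g y - g x = derive1 g c * (y - x).
  have gc a b : {within `[a, b], continuous g}.
    by apply: derivable_within_continuous => z _; exact: dg.
  have gd (z : R) : is_derive z 1 g (derive1 g z).
    by rewrite derive1E; exact: derivableP.
  have [xy|yx] := leP x y.
    have [c] := MVT_segment xy (fun z _ => gd z) (gc _ _).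
    rewrite in_itv/= => /andP[xc cy] E; exists c => //.
    by rewrite !ler0_norm ?subr_le0//; lra.
  have [c] := MVT_segment (ltW yx) (fun z _ => gd z) (gc _ _).
  rewrite in_itv/= => /andP[yc cx] E; exists c; last by lra.
  by rewrite !ger0_norm ?subr_ge0 ?(ltW yx)//; lra.
rewrite -mulrBl normrM -(@real_normK _ (y - x)) ?num_real//.
rewrite expr2 mulrA ler_wpM2r//.
have := H c (le_lt_trans cc yr); rewrite /GRing.scale/= mul1r => h.
apply: (@le_trans _ _ ((`|s| + 1) * `|c - x|)); last first.
  by rewrite ler_wpM2l ?addr_ge0// distrC [leRHS]distrC.
rewrite -[X in `|X|](subrK ((c - x) * s)) (le_trans (ler_normD _ _))//.
by rewrite [leRHS]mulrDl mul1r [leRHS]addrC lerD// normrM mulrC.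
Qed.

(** Adding the tangent bounds at [x] and [x + d] shows that the slope grows by at least [mu * d]; a
    linearisation error of at most [mu / 2 * d] leaves a positive second derivative. *)
Lemma strongly_convex_derive2_gt0 g x : strongly_convex g ->
  (forall x, derivable g x 1) -> derivable (derive1 g) x 1 ->
  0 < derive1 (derive1 g) x.
Proof.
move=> cvx dg ddg; have [mu mu0 tg] := strongly_convex_tangent cvx dg.
have := derivableP ddg; rewrite -derive1E => /is_derive1_nearP.
have mu20 : 0 < mu / 2 by rewrite divr_gt0.
set s : R := derive1 (derive1 g) x => /(_ _ mu20)[r /= r0].
have r20 : 0 < r / 2 by rewrite divr_gt0.
move=> /(_ (x + r / 2)); rewrite /ball_/= opprD addrA subrr add0r normrN.
rewrite [x + _ - x]addrAC subrr add0r gtr0_norm// /GRing.scale/=.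
have rr : r / 2 < r by lra.
move=> /(_ rr); rewrite ler_norml => /andP[_].
have := tg x (x + r / 2); have := tg (x + r / 2) x.
have -> : x - (x + r / 2) = - (r / 2) by lra.
have -> : x + r / 2 - x = r / 2 by lra.
rewrite sqrrN; set d := r / 2.
set gy : R := derive1 g _; set gx : R := derive1 g x.
move=> h1 h2 h3.
have h4 : mu * d <= gy - gx.
  rewrite -(ler_pM2r r20) -/d; move: h1 h2; rewrite expr2. lra.
rewrite -(pmulr_rgt0 _ r20) -/d.
have : 0 < mu * d by rewrite mulr_gt0.
by move: h3 h4; lra.
Qed.

End strong_convexity.

(** * Weighted Laplacians *)

Section moore_penrose_inverse.
Variables (R : realType) (n : nat) (L : 'M[R]_n).

(** The orthogonal projection onto the constants, where [L] vanishes: [L + Pi] is the identity there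
    and acts as [L] on the orthogonal complement. *)
Local Notation Pi := (const_mx n%:R^-1 : 'M[R]_n).

Hypotheses (symL : L^T = L) (LPi : L *m Pi = 0) (unitM : L + Pi \in unitmx).

Lemma trmx_averaging : Pi^T = Pi.
Proof. by apply/matrixP => i j; rewrite !mxE. Qed.

Lemma averagingL : Pi *m L = 0.
Proof. by rewrite -[LHS]trmxK trmx_mul symL trmx_averaging LPi trmx0. Qed.

Lemma averaging_idem : Pi *m Pi = Pi.
Proof.
apply/matrixP => i j; rewrite !mxE.
under eq_bigr do rewrite !mxE.
rewrite sumr_const card_ord -(mulr_natr (_ / _)) mulfVK// pnatr_eq0.
by case: n i => [[]|].
Qed.

Lemma mulmx_inv_shift : L *m invmx (L + Pi) = 1%:M - Pi.
Proof.
apply: (can_inj (mulmxK unitM)).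
rewrite mulmxKV// mulmxBl mul1mx mulmxDr averagingL averaging_idem.
by rewrite add0r addrK.
Qed.

Lemma inv_shift_mulmx : invmx (L + Pi) *m L = 1%:M - Pi.
Proof.
apply: (can_inj (mulKmx unitM)).
by rewrite mulKVmx// mulmxBr mulmx1 mulmxDl LPi averaging_idem add0r addrK.
Qed.

(** Subtracting [Pi] removes the action of the inverse on constants; both products then equal the
    symmetric projection [1%:M - Pi]. *)
Lemma moore_penrose_shift : moore_penrose L (invmx (L + Pi) - Pi).
Proof.
have inv_Pi : Pi *m invmx (L + Pi) = Pi.
  apply: (can_inj (mulmxK unitM)).
  by rewrite mulmxKV// mulmxDr averagingL averaging_idem add0r.
have LX : L *m (invmx (L + Pi) - Pi) = 1%:M - Pi.
  by rewrite mulmxBr LPi subr0 mulmx_inv_shift.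
have XL : (invmx (L + Pi) - Pi) *m L = 1%:M - Pi.
  by rewrite mulmxBl averagingL subr0 inv_shift_mulmx.
split; rewrite ?LX ?XL.
- by rewrite mulmxBl mul1mx averagingL subr0.
- rewrite mulmxBl mul1mx mulmxBr inv_Pi averaging_idem.
  by rewrite subrr subr0.
- by rewrite linearB/= trmx1 trmx_averaging.
- by rewrite linearB/= trmx1 trmx_averaging.
Qed.

Lemma pinvP : moore_penrose L (Defs.pinv L).
Proof.
by apply: (xgetPex 0); exists (invmx (L + Pi) - Pi); exact: moore_penrose_shift.
Qed.

End moore_penrose_inverse.

(** * Incidence matrix and Laplacian of a connected graph *)

Section incidence_matrix.
Variables (R : realType) (n m : nat) (src tgt : 'I_m -> 'I_n).

Local Notation A := (incidence src tgt R).

Hypothesis loopless : forall e, src e != tgt e.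

Lemma incidence_trmx p (Y : 'M[R]_(n, p)) e j :
  (A^T *m Y) e j = Y (src e) j - Y (tgt e) j.
Proof.
rewrite mxE (bigD1 (src e))//= (bigD1 (tgt e)) 1?eq_sym//= big1.
  by rewrite !mxE !eqxx (negPf (loopless e)) mul1r mulN1r addr0.
move=> v /andP[/negPf vs /negPf vt].
by rewrite !mxE eq_sym vs eq_sym vt mul0r.
Qed.

Lemma const_mul_incidence p (a : R) : (const_mx a : 'M[R]_(p, n)) *m A = 0.
Proof.
rewrite -[LHS]trmxK trmx_mul; apply/matrixP => i j.
by rewrite mxE incidence_trmx !mxE subrr.
Qed.

Hypothesis conn : connected_graph src tgt.

Lemma incidence_trmx_eq0 p (Y : 'M[R]_(n, p)) u v j :
  A^T *m Y = 0 -> Y u j = Y v j.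
Proof.
move=> AY; have adjE x y : Defs.adjacent src tgt x y -> Y x j = Y y j.
  move=> /existsP[e]; have /matrixP/(_ e j) := AY.
  rewrite incidence_trmx mxE => /eqP; rewrite subr_eq0 => /eqP YE.
  by case/orP => /andP[/eqP<- /eqP<-].
have /connectP[s sp ->] := conn u v.
elim: s u sp => //= x s IH u /andP[ux xs]; rewrite (adjE _ _ ux); exact: IH.
Qed.

Variable s : 'I_m -> R.
Hypothesis s_gt0 : forall e, 0 < s e.

(** The factored form makes symmetry and the kernel visible; [wlaplacianE] identifies it with
    degrees minus weights. *)
Definition wlaplacian : 'M[R]_n := A *m diag_mx (\row_e s e) *m A^T.

Local Notation L := wlaplacian.
Local Notation Pi := (const_mx n%:R^-1 : 'M[R]_n).

(** With [Z = A^T *m Y], a diagonal entry of [Y^T *m L *m Y] is the sum of the nonnegative terms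
    [s e * Z e j ^+ 2], so each of them vanishes. *)
Lemma wlaplacian_ker p (Y : 'M[R]_(n, p)) : L *m Y = 0 -> A^T *m Y = 0.
Proof.
move=> LY; apply/matrixP => e j; rewrite [RHS]mxE; set Z := A^T *m Y.
have : (Z^T *m diag_mx (\row_e s e) *m Z) j j = 0.
  rewrite /Z trmx_mul trmxK -!mulmxA [A *m _]mulmxA [_ *m (_ *m Y)]mulmxA.
  by rewrite LY mulmx0 mxE.
clearbody Z; rewrite mul_mx_diag mxE => /eqP; rewrite psumr_eq0.
  move=> /allP/(_ e (mem_index_enum _)); rewrite !mxE mulrAC mulf_eq0.
  by rewrite (gt_eqF (s_gt0 _)) orbF mulf_eq0 orbb => /eqP.
move=> i _; rewrite !mxE mulrAC.
by apply: mulr_ge0; [rewrite -expr2 sqr_ge0|exact: ltW].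
Qed.

Lemma wlaplacian_sym : L^T = L.
Proof. by rewrite /L !trmx_mul trmxK tr_diag_mx mulmxA. Qed.

Lemma const_wlaplacian p a : (const_mx a : 'M[R]_(p, n)) *m L = 0.
Proof. by rewrite /L !mulmxA const_mul_incidence !mul0mx. Qed.

Lemma wlaplacian_const p a : L *m (const_mx a : 'M[R]_(n, p)) = 0.
Proof.
rewrite -[LHS]trmxK trmx_mul wlaplacian_sym.
suff -> : (const_mx a : 'M[R]_(n, p))^T = const_mx a :> 'M[R]_(p, n).
  by rewrite const_wlaplacian trmx0.
by apply/matrixP => i j; rewrite !mxE.
Qed.

(** If [v] kills [L + Pi], multiplying by [Pi] gives [v *m Pi = 0], hence [v *m L = 0]; then [v] is
    constant by connectedness, and its mean is zero. *)
Lemma wlaplacian_shift_unit : L + Pi \in unitmx.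
Proof.
rewrite unitmxE unitfE; apply/negP => /det0P[v v0 vM].
have vPi : v *m Pi = 0.
  have := congr1 (mulmx^~ Pi) vM.
  rewrite mulmxDr mulmxDl -2!(mulmxA v) wlaplacian_const mulmx0 add0r.
  by rewrite averaging_idem mul0mx.
have Lv : L *m v^T = 0.
  rewrite -wlaplacian_sym -trmx_mul; apply: (canLR trmxK); rewrite trmx0.
  by move: vM; rewrite mulmxDr vPi addr0.
have vc := incidence_trmx_eq0 _ _ _ (wlaplacian_ker Lv).
case/negP: v0; apply/eqP/rowP => i; rewrite [RHS]mxE.
have /matrixP/(_ 0 i) := vPi; rewrite !mxE.
rewrite (eq_bigr (fun=> v 0 i / n%:R)); last first.
  by move=> j _; rewrite mxE; congr (_ / _); have := vc j i 0; rewrite !mxE.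
rewrite sumr_const card_ord -(mulr_natr (_ / _)) mulfVK// pnatr_eq0.
by case: n i {v vM vPi Lv vc} => [[]|].
Qed.

Lemma incidence_trmx_pinv : A^T *m Defs.pinv L *m L = A^T.
Proof.
have [LXL _ _ _] :=
  pinvP wlaplacian_sym (wlaplacian_const _ _) wlaplacian_shift_unit.
apply/eqP; rewrite -subr_eq0 -mulmxA -[X in _ - X]mulmx1 -mulmxBr; apply/eqP.
by apply: wlaplacian_ker; rewrite mulmxBr mulmxA LXL mulmx1 subrr.
Qed.

Lemma wlaplacian_solve p (Y : 'M[R]_(n, p)) :
  (const_mx 1 : 'rV_n) *m Y = 0 -> L *m (invmx (L + Pi) *m Y) = Y.
Proof.
move=> Y0; rewrite mulmxA mulmx_inv_shift ?wlaplacian_sym//.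
- have -> : Pi = (const_mx n%:R^-1 : 'cV[R]_n) *m (const_mx 1 : 'rV_n).
    by apply/matrixP => i j; rewrite !mxE big_ord1 !mxE mulr1.
  by rewrite mulmxBl mul1mx -mulmxA Y0 mulmx0 subr0.
- exact: wlaplacian_const.
- exact: wlaplacian_shift_unit.
Qed.

End incidence_matrix.

(** * Reversible random walks *)

Section reversible_walk.
Variables (R : realType) (n : nat) (W P : 'M[R]_n) (d : 'I_n -> R).
Hypotheses (W_sym : forall u v, W u v = W v u) (W_ge0 : forall u v, 0 <= W u v).
Hypotheses (d_gt0 : forall v, 0 < d v) (dE : forall v, d v = \sum_u W v u).
Hypothesis dP : forall u v, d u * P u v = W u v.

Definition energy p (X : 'M[R]_(n, p)) j : R := \sum_v d v * X v j ^+ 2.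

Lemma transition_ge0 u v : 0 <= P u v.
Proof. by rewrite -(pmulr_rge0 _ (d_gt0 u)) dP. Qed.

Lemma transition_row_sum u : \sum_v P u v = 1.
Proof.
apply: (mulfI (lt0r_neq0 (d_gt0 u))); rewrite mulr_sumr mulr1 [RHS]dE.
by apply: eq_bigr => v _; rewrite dP.
Qed.

(* The energy lost in one step at u is d u times the variance of X . j under
   the distribution P u . *)
Lemma energy_drop p (X : 'M[R]_(n, p)) j :
  (energy X j - energy (P *m X) j) *+ 2 =
  \sum_u d u * \sum_v \sum_w P u v * P u w * (X v j - X w j) ^+ 2.
Proof.
have step u : d u * (\sum_v \sum_w P u v * P u w * (X v j - X w j) ^+ 2) =
    (\sum_v W u v * X v j ^+ 2 - d u * (P *m X) u j ^+ 2) *+ 2.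
  rewrite mxE; set S := \sum_v P u v * X v j.
  have -> : \sum_v W u v * X v j ^+ 2 = d u * \sum_v P u v * X v j ^+ 2.
    by rewrite mulr_sumr; apply: eq_bigr => v _; rewrite mulrA dP.
  set Q := \sum_v P u v * X v j ^+ 2.
  have -> : \sum_v \sum_w P u v * P u w * (X v j - X w j) ^+ 2 =
      \sum_v (P u v * X v j ^+ 2 - P u v * X v j * S *+ 2 + P u v * Q).
    apply: eq_bigr => v _.
    transitivity (P u v * X v j ^+ 2 * \sum_w P u w -
        P u v * X v j * S *+ 2 + P u v * Q).
      2: by rewrite transition_row_sum mulr1.
    rewrite /S /Q !mulr_sumr -sumrMnl -sumrN -!big_split/=.
    by apply: eq_bigr => w _; ring.
  rewrite !big_split/= sumrN sumrMnl -!mulr_suml transition_row_sum.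
  by rewrite -/S -/Q; ring.
rewrite (eq_bigr _ (fun u _ => step u)) sumrMnl; congr (_ *+ 2).
(* Summing over [u] first turns the weights at [v] into [d v], by symmetry of [W]. *)
rewrite sumrB; congr (_ - _); rewrite exchange_big/=; apply: eq_bigr => v _.
by rewrite dE mulr_suml; apply: eq_bigr => u _; rewrite W_sym.
Qed.

Lemma energy_ge0 p (X : 'M[R]_(n, p)) j : 0 <= energy X j.
Proof. by apply: sumr_ge0 => v _; rewrite mulr_ge0 ?sqr_ge0// ltW. Qed.

(** A single term of the nonnegative triple sum in [energy_drop]. *)
Lemma energy_drop_ge p (X : 'M[R]_(n, p)) j u v w :
  d u * P u v * P u w * (X v j - X w j) ^+ 2 <=
  (energy X j - energy (P *m X) j) *+ 2.
Proof.
have ge0 u' v' w' : 0 <= P u' v' * P u' w' * (X v' j - X w' j) ^+ 2.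
  by apply: mulr_ge0 (sqr_ge0 _); apply: mulr_ge0; exact: transition_ge0.
rewrite energy_drop (bigD1 u)//= (bigD1 v)//= (bigD1 w)//=.
rewrite -!addrA mulrDr !mulrA.
have sum_ge0 u' (Q : pred 'I_n) :
    0 <= d u' * \sum_(v' | Q v') \sum_w'
      P u' v' * P u' w' * (X v' j - X w' j) ^+ 2.
  apply: mulr_ge0; first exact: ltW.
  by apply: sumr_ge0 => v' _; apply: sumr_ge0.
rewrite -[leRHS]addrA lerDl addr_ge0//; last first.
  by apply: sumr_ge0 => i _; exact: sum_ge0.
apply: mulr_ge0; [exact: ltW|apply: addr_ge0; apply: sumr_ge0 => // i _].
by apply: sumr_ge0.
Qed.

Lemma energy_nonincreasing p (X : 'M[R]_(n, p)) j :
  nonincreasing_seq (fun t => energy (P ^+ t *m X) j).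
Proof.
apply/nonincreasing_seqP => t; rewrite exprS -[P * _]/(P *m _) -mulmxA.
rewrite -subr_ge0 -(pmulrn_lge0 _ (ltn0Sn 1)) energy_drop.
apply: sumr_ge0 => u _; apply: mulr_ge0; first exact: ltW.
apply: sumr_ge0 => v _; apply: sumr_ge0 => w _.
by apply: mulr_ge0 (sqr_ge0 _); apply: mulr_ge0; exact: transition_ge0.
Qed.

(** The energy never exceeds its initial value and dominates [d v * y ^+ 2]; the bound
    [|y| <= y ^+ 2 + 1] avoids a square root. *)
Lemma walk_bounded p (X : 'M[R]_(n, p)) v j :
  exists C : R, forall t, `|(P ^+ t *m X) v j| <= C.
Proof.
exists (energy X j / d v + 1) => t; set y := (P ^+ t *m X) v j.
apply: (@le_trans _ _ (y ^+ 2 + 1)).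
  rewrite -(@real_normK _ y) ?num_real// -subr_ge0.
  have -> : `|y| ^+ 2 + 1 - `|y| = (`|y| - 2^-1) ^+ 2 + 3 / 4 by field.
  by rewrite addr_ge0 ?sqr_ge0.
rewrite lerD2r ler_pdivlMr// mulrC.
apply: (@le_trans _ _ (energy (P ^+ t *m X) j)).
  rewrite /energy (bigD1 v)//= lerDl; apply: sumr_ge0 => w _.
  by apply: mulr_ge0 (sqr_ge0 _); exact: ltW.
by have := energy_nonincreasing X j (leq0n t); rewrite expr0 mul1mx.
Qed.

(** The energy decreases and is bounded below, so its drops tend to 0; each drop controls the
    squared difference with the positive factor [d u * P u v * P u w]. *)
Lemma walk_common_neighbor_cvg p (X : 'M[R]_(n, p)) j u v w :
  0 < W u v -> 0 < W u w ->
  (P ^+ t *m X) v j - (P ^+ t *m X) w j @[t --> \oo] --> 0.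
Proof.
move=> uv uw; pose E t := energy (P ^+ t *m X) j.
have cE : cvgn E.
  apply: nonincreasing_is_cvgn; first exact: energy_nonincreasing.
  by exists 0 => _ [t _ <-]; exact: energy_ge0.
have drop0 : (E t - E t.+1) *+ 2 @[t --> \oo] --> 0.
  rewrite -(mul0rn _ 2) -(subrr (limn E)); apply: cvgMn; apply: cvgB => //.
  by rewrite (cvg_shiftS E).
pose c := d u * P u v * P u w.
have c0 : 0 < c.
  by rewrite /c dP mulr_gt0// -(pmulr_rgt0 _ (d_gt0 u)) dP.
apply/cvgr0Pnorm_le => e e0.
have ce0 : 0 < c * e ^+ 2 by rewrite mulr_gt0// exprn_gt0.
move/cvgr0Pnorm_le : drop0 => /(_ _ ce0); apply: filterS => t /=.
move=> /(le_trans (ler_norm _)).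
rewrite /E exprS -[P * _]/(P *m _) -mulmxA.
move=> /(le_trans (energy_drop_ge _ j u v w)).
rewrite -/c ler_pM2l// => h.
by rewrite -ler_sqr ?nnegrE ?(ltW e0)// real_normK// num_real.
Qed.

End reversible_walk.

(** * The random walk of a weighted graph *)

Section graph_walk.
Variables (R : realType) (n m : nat) (src tgt : 'I_m -> 'I_n).
Hypotheses (simple : simple_digraph src tgt) (conn : connected_graph src tgt).
Variable s : 'I_m -> R.
Hypothesis s_gt0 : forall e, 0 < s e.

Local Notation A := (incidence src tgt R).
Local Notation adj := (Defs.adjacent src tgt).

Let loopless e : src e != tgt e := simple.1 e.

(** A sum over joining edges, with at most one term in a simple digraph, compares directly with the
    edge sum in [wlaplacian]. *)
Definition wadjacency : 'M[R]_n :=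
  \matrix_(u, v) \sum_(e | joins src tgt e u v) s e.

Definition wdegree : 'rV[R]_n := \row_v \sum_u wadjacency v u.

Definition walk : 'M[R]_n := invmx (diag_mx wdegree) *m wadjacency.

Local Notation L := (wlaplacian src tgt s).

Lemma joins_sym e u v : joins src tgt e u v = joins src tgt e v u.
Proof. by rewrite /joins orbC. Qed.

(** The identity is checked edge by edge: [AA] expands [A u e * A v e] in indicators, and the
    weights only multiply it. *)
Lemma wlaplacianE : diag_mx wdegree - wadjacency = L.
Proof.
have joinsE e u v : (joins src tgt e u v)%:R =
    (src e == u)%:R * (tgt e == v)%:R + (tgt e == u)%:R * (src e == v)%:R :> R.
  rewrite /joins -!natrM -natrD !mulnb; congr (_%:R).
  case: eqP => [<-|_]; last by rewrite andFb orFb add0n andbC.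
  by rewrite [tgt e == src e]eq_sym (negPf (loopless e)) andbF orbF andFb addn0.
have indic_sum (x : 'I_n) : \sum_v (x == v)%:R = 1 :> R.
  by rewrite (bigD1 x)//= eqxx big1 ?addr0// => v /negPf; rewrite eq_sym => ->.
have indicM (x u v : 'I_n) :
    (x == u)%:R * (x == v)%:R = (u == v)%:R * (x == u)%:R :> R.
  have [->|xu] := eqVneq x u; first by rewrite mul1r mulr1.
  by rewrite mul0r mulr0.
have AE e u : A u e = (src e == u)%:R - (tgt e == u)%:R.
  rewrite mxE; have [<-|] := eqVneq (src e) u.
    by rewrite eq_sym (negPf (loopless e)) subr0.
  by rewrite sub0r; case: ifP; rewrite ?oppr0.
have AA e u v : A u e * A v e =
    (u == v)%:R * (\sum_w (joins src tgt e u w)%:R) - (joins src tgt e u v)%:R.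
  under eq_bigr do rewrite joinsE.
  rewrite big_split/= -!mulr_sumr !indic_sum !mulr1 joinsE !AE.
  rewrite [(u == v)%:R * _]mulrDr -!indicM.
  by ring.
apply/matrixP => u v; rewrite !mxE.
under [in RHS]eq_bigr => e _.
  rewrite mul_mx_diag !mxE mulrAC.
  have := AA e u v; rewrite !mxE => ->; rewrite mulrBl.
  over.
rewrite sumrB; congr (_ - _); last first.
  rewrite big_mkcond/=; apply: eq_bigr => e _.
  by case: ifP; rewrite ?mul1r ?mul0r.
have [_|uv] := eqVneq u v; last first.
  by rewrite mulr0n big1// => e _; rewrite !mul0r.
rewrite mulr1n; under [RHS]eq_bigr do rewrite mul1r mulr_suml.
rewrite exchange_big/=; apply: eq_bigr => w _; rewrite mxE big_mkcond/=.
by apply: eq_bigr => e _; case: ifP; rewrite ?mul1r ?mul0r.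
Qed.

Lemma wadjacency_sym u v : wadjacency u v = wadjacency v u.
Proof. by rewrite !mxE; apply: eq_bigl => e; rewrite joins_sym. Qed.

Lemma wadjacency_ge0 u v : 0 <= wadjacency u v.
Proof. by rewrite mxE sumr_ge0// => e _; exact: ltW. Qed.

Lemma wadjacency_gt0 u v : adj u v -> 0 < wadjacency u v.
Proof.
move=> /existsP[e uv]; rewrite mxE (bigD1 e)//= ltr_pwDl// sumr_ge0// => e' _.
exact: ltW.
Qed.

Lemma adjacent_sym u v : adj u v = adj v u.
Proof. by apply: eq_existsb => e; rewrite joins_sym. Qed.

Hypothesis m_gt0 : (0 < m)%N.

(** One end of an existing edge differs from [v], so a path from [v] to it begins with an edge at
    [v]. *)
Lemma wdegree_gt0 v : 0 < wdegree 0 v.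
Proof.
pose e0 := Ordinal m_gt0.
have [u uv vu] : exists2 u, u != v & connect adj v u.
  have [<-|sv] := eqVneq (src e0) v; last by exists (src e0) => //; exact: conn.
  by exists (tgt e0); [rewrite eq_sym|exact: conn].
case/connectP : vu uv => -[/= _ ->|w q /= /andP[vw _] _ _].
  by rewrite eqxx.
rewrite mxE (bigD1 w)//= ltr_pwDl ?wadjacency_gt0// sumr_ge0// => x _.
exact: wadjacency_ge0.
Qed.

Let D_unit : diag_mx wdegree \in unitmx.
Proof.
rewrite unitmxE det_diag unitfE; apply/prodf_neq0 => v _.
by rewrite gt_eqF// wdegree_gt0.
Qed.

Lemma diag_walk : diag_mx wdegree *m walk = wadjacency.
Proof. by rewrite mulKVmx. Qed.

Lemma walkE u v : wdegree 0 u * walk u v = wadjacency u v.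
Proof. by rewrite -diag_walk mul_diag_mx [RHS]mxE. Qed.

Lemma wdegreeE v : wdegree 0 v = \sum_u wadjacency v u.
Proof. by rewrite mxE. Qed.

Definition two_step : rel 'I_n := fun u v => [exists w, adj w u && adj w v].

(* If both ends of some edge are at even distance from u then every vertex is;
   otherwise evenness of the distance from u is a 2-colouring. *)
Lemma nonbipartite_two_step u v : ~ bipartite_graph src tgt ->
  connect two_step u v.
Proof.
move=> nbip.
have nbr x y z : adj x y -> adj x z -> connect two_step y z.
  by move=> xy xz; apply/connect1/existsP; exists x; rewrite xy.
pose near_class x := connect two_step u x \/
  exists2 y, adj x y & connect two_step u y.
have near_last p x : path adj x p -> near_class x -> near_class (last x p).
  elim: p x => //= z p IH y /andP[yz zp] [uy|[w yw uw]].
    by apply: IH zp _; right; exists y => //; rewrite adjacent_sym.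
  by apply: IH zp _; left; apply: connect_trans uw (nbr _ _ _ yw yz).
have near_all x : near_class x.
  have /connectP[p up ->] := conn u x.
  by apply: near_last up _; left; exact: connect0.
have [e eq_e] :
    exists e, connect two_step u (src e) = connect two_step u (tgt e).
  apply: contrapT => H; apply: nbip; exists (connect two_step u) => e.
  by apply/eqP => eq_e; apply: H; exists e.
have st : adj (src e) (tgt e) by apply/existsP; exists e; rewrite /joins !eqxx.
(* A neighbour [y] of [src e] shares that vertex as a neighbour with [tgt e], so reaching [y] means
   reaching [tgt e], and [eq_e] transfers this to [src e]. *)
have us : connect two_step u (src e).
  case: (near_all (src e)) => // -[y sy uy]; rewrite eq_e.
  exact: connect_trans uy (nbr _ _ _ sy st).
have ut : connect two_step u (tgt e) by rewrite -eq_e.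
(* Invariant along the path to [v]: both ends of the current edge are reached by double steps. *)
have both x y : adj x y -> connect two_step u x -> connect two_step u y ->
    forall z, adj y z -> connect two_step u z.
  move=> xy ux uy z yz; apply: connect_trans ux (nbr _ _ _ _ yz).
  by rewrite adjacent_sym.
have /connectP[p] := conn (tgt e) v.
elim: p (src e) (tgt e) st us ut => [|z p IH] x y xy ux uy /=.
  by move=> _ ->.
move=> /andP[yz zp] vE; exact: IH yz uy (both _ _ xy ux uy _ yz) zp vE.
Qed.

(** A chain of double steps from [src e] to [tgt e] splits the difference into finitely many
    differences between vertices with a common neighbour. *)
Lemma nonbipartite_walk_cvg p (X : 'M[R]_(n, p)) e j :
  ~ bipartite_graph src tgt ->
  (A^T *m (walk ^+ t *m X)) e j @[t --> \oo] --> 0.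
Proof.
move=> nbip; under eq_fun do rewrite incidence_trmx//.
have /connectP[q] := nonbipartite_two_step (src e) (tgt e) nbip.
elim: q (src e) => [u _ ->|v q IH u].
  rewrite (_ : (fun t => _) = cst 0); first exact: cvg_cst.
  by apply/funext => t; rewrite subrr.
move=> /andP[/existsP[w /andP[wu wv]] vq] tE.
have uv := walk_common_neighbor_cvg wadjacency_sym wadjacency_ge0 wdegree_gt0
  wdegreeE walkE X j (wadjacency_gt0 wu) (wadjacency_gt0 wv).
rewrite (_ : (fun t => _) =
    (fun t => (walk ^+ t *m X) u j - (walk ^+ t *m X) v j) \+
    (fun t => (walk ^+ t *m X) v j - (walk ^+ t *m X) (tgt e) j)); last first.
  by apply/funext => t /=; rewrite addrA subrK.
have -> : 0 = 0 + 0 :> R by rewrite addr0.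
exact: cvgD uv (IH v vq tE).
Qed.

(** * The fundamental matrix and the sum of the walk series *)

Local Notation Pi := (const_mx n%:R^-1 : 'M[R]_n).

Definition stationary : 'rV[R]_n := (\sum_v wdegree 0 v)^-1 *: wdegree.

(* A solution X of (1 - walk) X = 1 - 1 stationary. *)
Definition fundamental : 'M[R]_n :=
  invmx (L + Pi) *m (diag_mx wdegree *m (1%:M - const_mx 1 *m stationary)).

Lemma wdegree_ones : wdegree *m (const_mx 1 : 'cV_n) = (\sum_v wdegree 0 v)%:M.
Proof.
apply/matrixP => i j; rewrite !ord1 !mxE mulr1n.
by apply: eq_bigr => v _; rewrite [X in _ * X]mxE mulr1.
Qed.

Lemma ones_diag_wdegree : (const_mx 1 : 'rV_n) *m diag_mx wdegree = wdegree.
Proof. by apply/rowP => v; rewrite mul_mx_diag !mxE mul1r. Qed.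

(** The right-hand side has zero column sums because [stationary] has total mass 1, so
    [wlaplacian_solve] applies. *)
Lemma wlaplacian_fundamental :
  L *m fundamental = diag_mx wdegree *m (1%:M - const_mx 1 *m stationary).
Proof.
rewrite wlaplacian_solve// mulmxA ones_diag_wdegree mulmxBr mulmx1 mulmxA.
rewrite wdegree_ones mul_scalar_mx scalerA divff ?scale1r ?subrr//.
pose v0 := src (Ordinal m_gt0).
rewrite gt_eqF// (bigD1 v0)//= ltr_pwDl ?wdegree_gt0// sumr_ge0// => v _.
by rewrite ltW// wdegree_gt0.
Qed.

(** Both potentials have the same image under [L]: the correction by [stationary] is proportional to
    the sum of the entries of [delta], which is 0 for [delta] in the range of [L]. *)
Lemma fundamental_solution (q delta : 'cV[R]_n) : L *m q = delta ->
  A^T *m (fundamental *m (invmx (diag_mx wdegree) *m delta)) = A^T *m q.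
Proof.
move=> Lq; apply/eqP; rewrite -subr_eq0 -mulmxBr; apply/eqP.
apply: (wlaplacian_ker (s := s)) => //.
rewrite mulmxBr Lq mulmxA wlaplacian_fundamental -mulmxA mulmxBl mul1mx.
have st0 : stationary *m (invmx (diag_mx wdegree) *m delta) = 0.
  rewrite /stationary -[X in _ *: X]ones_diag_wdegree -scalemxAl -mulmxA.
  rewrite mulKVmx// -Lq.
  by rewrite mulmxA const_wlaplacian// mul0mx scaler0.
by rewrite -(mulmxA _ stationary) st0 mulmx0 subr0 mulKVmx// subrr.
Qed.

Lemma walk_ones p (Y : 'M[R]_(1, p)) t :
  walk ^+ t *m ((const_mx 1 : 'cV_n) *m Y) = (const_mx 1 : 'cV_n) *m Y.
Proof.
elim: t => [|t IH]; first by rewrite expr0 mul1mx.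
rewrite exprSr -[_ * walk]/(_ *m walk) -mulmxA [walk *m _]mulmxA.
suff -> : walk *m (const_mx 1 : 'cV_n) = const_mx 1 by [].
apply/colP => v; rewrite !mxE.
under eq_bigr do rewrite [const_mx _ _ _]mxE mulr1.
exact: transition_row_sum wdegree_gt0 wdegreeE walkE v.
Qed.

(* fundamental *m X - walk *m (fundamental *m X) is X up to constant columns,
   which walk preserves and A^T kills. *)
Lemma walk_telescope p (X : 'M[R]_(n, p)) t :
  A^T *m (walk ^+ t *m X) =
  A^T *m (walk ^+ t *m (fundamental *m X)) -
  A^T *m (walk ^+ t.+1 *m (fundamental *m X)).
Proof.
rewrite exprSr -[_ * walk]/(_ *m walk) -mulmxBr -mulmxA -mulmxBr.
have -> : fundamental *m X - walk *m (fundamental *m X) =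
    X - (const_mx 1 : 'cV_n) *m (stationary *m X).
  apply: (can_inj (mulKmx D_unit)).
  rewrite mulmxBr [diag_mx _ *m (walk *m _)]mulmxA diag_walk -mulmxBl.
  rewrite wlaplacianE.
  by rewrite (mulmxA L) wlaplacian_fundamental -mulmxA mulmxBl mul1mx -mulmxA.
rewrite mulmxBr walk_ones mulmxBr [X in _ - X](_ : _ = 0) ?subr0//.
apply/matrixP => i j; rewrite incidence_trmx// [RHS]mxE; apply/eqP.
by rewrite subr_eq0 !mxE; apply/eqP; apply: eq_bigr => k _; rewrite !mxE.
Qed.

Lemma series_walk_diff (e : 'I_m) (z : 'I_n) N :
  series (fun t => (walk ^+ t) (src e) z - (walk ^+ t) (tgt e) z) N =
  (A^T *m fundamental) e z - (A^T *m (walk ^+ N *m fundamental)) e z.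
Proof.
have E t : (walk ^+ t) (src e) z - (walk ^+ t) (tgt e) z =
    (A^T *m (walk ^+ t *m fundamental)) e z -
    (A^T *m (walk ^+ t.+1 *m fundamental)) e z.
  have := walk_telescope 1%:M t; rewrite !mulmx1 => /matrixP/(_ e z).
  rewrite incidence_trmx// => ->; rewrite [LHS]mxE; congr (_ + _).
  by rewrite mxE.
rewrite seriesEnat /= (eq_bigr _ (fun t _ => E t)).
under eq_bigr do rewrite -opprB.
by rewrite sumrN telescope_sumr// opprB expr0 mul1mx.
Qed.

Definition edge_walk_diff (e : 'I_m) (z : 'I_n) : R^nat :=
  fun t => (walk ^+ t) (src e) z - (walk ^+ t) (tgt e) z.

Lemma series_walk_diff_cvg e z : ~ bipartite_graph src tgt ->
  series (edge_walk_diff e z) @ \oo --> (A^T *m fundamental) e z.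
Proof.
move=> nbip; rewrite (funext (series_walk_diff e z)).
rewrite -[X in _ --> X]subr0; apply: cvgB; first exact: cvg_cst.
exact: nonbipartite_walk_cvg.
Qed.

(** By [walk_telescope] the remainder of the series is itself a difference of consecutive terms of
    the bounded sequence [v], so the mean of the remainders is an end difference divided by
    [k.+1]. *)
Lemma cesaro_walk_diff_cvg e z :
  cesaro_means (edge_walk_diff e z) @ \oo --> (A^T *m fundamental) e z.
Proof.
pose v t := (A^T *m (walk ^+ t *m (fundamental *m fundamental))) e z.
have vE t : (A^T *m (walk ^+ t *m fundamental)) e z = v t - v t.+1.
  rewrite walk_telescope [LHS]mxE; congr (_ + _); by rewrite mxE.
(* The averaged partial sums have 1 to [k.+1] terms, so the telescoped range goes from [v 1] to
   [v k.+2]. *)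
have meanE k : cesaro_means (edge_walk_diff e z) k =
    (A^T *m fundamental) e z - (v 1%N - v k.+2) / k.+1%:R.
  rewrite /cesaro_means /arithmetic_mean /= seriesEnat/=.
  under eq_bigr do rewrite series_walk_diff vE opprB.
  rewrite big_split/= sumr_const_nat subn0.
  rewrite (telescope_sumr (fun i => v i.+1))// -[X in X + _]mulr_natr mulrDr.
  by rewrite mulrCA mulVf ?pnatr_eq0// mulr1 -[v k.+2 - _]opprB mulrN mulrC.
have [C vC] : exists C, forall t, `|v t| <= C.
  have bnd x := walk_bounded wadjacency_sym wadjacency_ge0 wdegree_gt0
    wdegreeE walkE (fundamental *m fundamental) x z.
  have [C1 h1] := bnd (src e); have [C2 h2] := bnd (tgt e).
  exists (C1 + C2) => t; rewrite /v incidence_trmx//.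
  exact: le_trans (ler_normB _ _) (lerD (h1 t) (h2 t)).
rewrite (funext meanE) -[X in _ --> X]subr0; apply: cvgB; first exact: cvg_cst.
apply/cvgr0Pnorm_le => eps eps0.
have C0 : 0 <= C by apply: le_trans (vC 0%N).
near=> k; rewrite normrM normfV normr_nat ler_pdivrMr//.
apply: le_trans (ler_normB _ _) _; apply: le_trans (lerD (vC _) (vC _)) _.
rewrite -ler_pdivrMl// mulrC.
apply: (@le_trans _ _ k%:R); last by rewrite ler_nat.
by near: k; exact: nbhs_infty_ger.
Unshelve. all: by end_near. Qed.

Lemma edge_flow_formula (q delta : 'cV[R]_n) (e : 'I_m) : L *m q = delta ->
  \sum_z (wdegree 0 z)^-1 * delta z 0 * (A^T *m fundamental) e z =
  (A^T *m q) e 0.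
Proof.
move=> Lq; rewrite -(fundamental_solution Lq) mulmxA [RHS]mxE.
apply: eq_bigr => z _; rewrite mulrC; congr (_ * _).
have wz := lt0r_neq0 (wdegree_gt0 z); apply: (mulfI wz); rewrite mulVKf//.
by rewrite -[in LHS](mulKVmx D_unit delta) mul_diag_mx mxE.
Qed.

End graph_walk.

(** * The network's matrices as those of a weighted graph *)

Section network_walk.
Variables (R : realType) (n m : nat) (src tgt : 'I_m -> 'I_n).
Variables (f : 'I_m -> R -> R) (b : 'cV[R]_n).
Hypothesis simple : simple_digraph src tgt.

Local Notation s := (Defs.sigma src tgt f b).

(** Simplicity makes the edge found by [pick] the only one joining [u] and [v], so the sum has one
    term. *)
Lemma weightE : weight src tgt f b = wadjacency src tgt s.
Proof.
apply/matrixP => u v; rewrite !mxE; case: pickP => [e uv|none]; last first.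
  by rewrite big_pred0.
rewrite (big_pred1 e)// => e' /=; apply/idP/eqP => [uv'|->//].
apply: simple.2; move: uv uv'; rewrite /joins.
by case/orP => /andP[/eqP-> /eqP->] //; rewrite orbC.
Qed.

Lemma degreeE : degree src tgt f b = wdegree src tgt s.
Proof. by rewrite /degree weightE. Qed.

Lemma laplacianE : laplacian src tgt f b = wlaplacian src tgt s.
Proof. by rewrite /laplacian degreeE weightE wlaplacianE. Qed.

Lemma walk_diffE e z : walk_diff src tgt f b e z = edge_walk_diff src tgt s e z.
Proof. by rewrite /walk_diff /transition degreeE weightE. Qed.

End network_walk.

(** * Limits of matrices *)

Section matrix_limits.
Context {R : realType}.

Lemma mx_entry_norm_le p q (M : 'M[R]_(p, q)) i j : `|M i j| <= `|M|.
Proof. by rewrite [leRHS]/Num.Def.normr/= mx_normrE (le_bigmax _ _ (i, j)). Qed.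

Lemma mx_norm_le p q (M : 'M[R]_(p, q)) (c : R) : 0 <= c ->
  (forall i j, `|M i j| <= c) -> `|M| <= c.
Proof.
by move=> c0 Mc; rewrite [leLHS]/Num.Def.normr/= mx_normrE bigmax_le// => -[].
Qed.

Lemma mulmx_norm_bound p q r (M : 'M[R]_(p, q)) :
  exists2 C : R, 0 < C & forall x : 'M[R]_(q, r), `|M *m x| <= C * `|x|.
Proof.
have s0 : 0 <= \sum_i \sum_j `|M i j|.
  by apply: sumr_ge0 => i _; exact: sumr_ge0.
(* The summand 1 keeps the constant positive when [M] is zero. *)
exists (1 + \sum_i \sum_j `|M i j|); first by rewrite ltr_pwDl.
move=> x; apply: mx_norm_le => [|i j]; first by rewrite mulr_ge0// addr_ge0.
rewrite mxE (le_trans (ler_norm_sum _ _ _))//.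
apply: (@le_trans _ _ ((\sum_k `|M i k|) * `|x|)).
  rewrite mulr_suml; apply: ler_sum => k _.
  by rewrite normrM ler_wpM2l// mx_entry_norm_le.
rewrite ler_wpM2r// ler_wpDl// (bigD1 i)//= lerDl.
by apply: sumr_ge0 => k _; exact: sumr_ge0.
Qed.

Section cvg.
Context {T : Type} {F : set_system T} {FF : Filter F}.

Lemma cvg_mxP p q (M : T -> 'M[R]_(p, q)) (N : 'M[R]_(p, q)) :
  (forall i j, M t i j @[t --> F] --> N i j) <-> M @ F --> N.
Proof.
split=> [MN|MN i j]; last first.
  by apply: (cvg_comp M (fun N => N i j)) MN _; exact: coord_continuous.
apply/cvgrPdist_le => e e0; near=> t; apply: mx_norm_le (ltW e0) _.
move=> i j; rewrite !mxE; move: i j; near: t.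
apply: filter_forall => i; apply: filter_forall => j.
by move/cvgrPdist_le : (MN i j); apply.
Unshelve. all: by end_near. Qed.

Lemma cvg_mulmx p q r (M : T -> 'M[R]_(p, q)) (N : T -> 'M[R]_(q, r))
    (M0 : 'M[R]_(p, q)) (N0 : 'M[R]_(q, r)) :
  M @ F --> M0 -> N @ F --> N0 -> M t *m N t @[t --> F] --> M0 *m N0.
Proof.
move=> /cvg_mxP MM /cvg_mxP NN; apply/cvg_mxP => i j.
under eq_fun do rewrite mxE.
by rewrite mxE; apply: cvg_big => [|k _]; [exact: add_continuous|apply: cvgM].
Qed.

Lemma cvg_det p (M : T -> 'M[R]_p) (M0 : 'M[R]_p) :
  M @ F --> M0 -> \det (M t) @[t --> F] --> \det M0.
Proof.
move=> /cvg_mxP MM; rewrite /determinant.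
apply: cvg_big => [|s _]; first exact: add_continuous.
apply: cvgM; first exact: cvg_cst.
by apply: cvg_big => [|i _]; [exact: mul_continuous|exact: MM].
Qed.

(** Near [M0] the determinant stays nonzero, so the inverse is the adjugate over the determinant,
    whose entries converge. *)
Lemma cvg_invmx p (M : T -> 'M[R]_p) (M0 : 'M[R]_p) : M0 \in unitmx ->
  M @ F --> M0 -> invmx (M t) @[t --> F] --> invmx M0.
Proof.
move=> uM MM; have detM := cvg_det MM.
have d0 : \det M0 != 0 by rewrite -unitfE -unitmxE.
have invE : \forall t \near F, (\det (M t))^-1 *: \adj (M t) = invmx (M t).
  have /cvgrPdist_lt/(_ `|\det M0|) := detM; rewrite normr_gt0 => /(_ d0).
  apply: filterS => t h; rewrite /invmx unitmxE unitfE ifT//.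
  by apply: contraTN h => /eqP->; rewrite subr0 ltxx.
apply: cvg_trans (near_eq_cvg invE) _.
rewrite /invmx uM; apply/cvg_mxP => i j; rewrite !mxE.
under eq_fun do rewrite !mxE.
apply: cvgM; first exact: cvgV.
apply: cvgM; first exact: cvg_cst.
apply: cvg_det; apply/cvg_mxP => k l; rewrite !mxE.
under eq_fun do rewrite !mxE.
by move/cvg_mxP : MM; apply.
Qed.

End cvg.
End matrix_limits.

(** * Existence and optimality conditions *)

Section total_cost_calculus.
Variables (R : realType) (m : nat) (f : 'I_m -> R -> R).

Hypothesis df : forall e x, derivable (f e) x 1.

(** Both sides have the same difference quotient, so directional derivatives reduce to one
    variable. *)
Lemma is_derive_line (V W : normedModType R) (F : V -> W) x v (t : R) dF :
  is_derive (t *: v + x) v F dF <->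
  is_derive t (1 : R) (fun s : R => F (s *: v + x)) dF.
Proof.
have E : (fun h : R => h^-1 *: (F (h *: v + (t *: v + x)) - F (t *: v + x))) =
    (fun h : R =>
       h^-1 *: (F ((h *: (1 : R) + t : R) *: v + x) - F (t *: v + x))).
  by apply/funext => h; rewrite [h *: 1]mulr1 scalerDl addrA.
by split=> -[+ dFE]; rewrite /derivable ?E -?E => cv; apply: DeriveDef;
  rewrite /derivable /derive ?E -?E// -dFE /derive ?E -?E.
Qed.

Lemma is_derive_coord (g : R -> R) p (y v : 'cV[R]_p) e :
  derivable g (y e 0) 1 ->
  is_derive y v (fun x : 'cV[R]_p => g (x e 0)) (derive1 g (y e 0) * v e 0).
Proof.
move=> dg.
suff : is_derive ((0 : R) *: v + y) v (fun x : 'cV[R]_p => g (x e 0))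
    (derive1 g (y e 0) * v e 0) by rewrite scale0r add0r.
apply/is_derive_line.
have -> : (fun t : R => g ((t *: v + y) e 0)) =
    g \o (fun t => t * v e 0 + y e 0).
  by apply/funext => t /=; rewrite !mxE.
apply: is_derive1_comp.
  by rewrite mul0r add0r derive1E; exact: derivableP.
apply/is_derive1_nearP => eps eps0; near=> t.
rewrite mul0r add0r subr0 addrK /GRing.scale/= subrr normr0.
by rewrite mulr_ge0// ltW.
Unshelve. all: by end_near. Qed.

Lemma is_derive_total_cost (y v : 'cV[R]_m) :
  is_derive y v (total_cost f) (\sum_e derive1 (f e) (y e 0) * v e 0).
Proof.
have -> : total_cost f = \sum_e (fun x : 'cV[R]_m => f e (x e 0)).
  by apply/funext => x; rewrite fct_sumE.
by apply: is_derive_sum => e; apply: is_derive_coord; exact: df.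
Qed.

Definition gradient (x : 'cV[R]_m) : 'cV[R]_m := \col_e derive1 (f e) (x e 0).

(** The cost is separable: its [j]-th partial derivative depends on the coordinate [j] alone. *)
Lemma hessian_total_cost (x : 'cV[R]_m) :
  (forall e x, derivable (derive1 (f e)) x 1) ->
  hessian (total_cost f) x =
  diag_mx (\row_e derive1 (derive1 (f e)) (x e 0)).
Proof.
move=> ddf; apply/matrixP => i j; rewrite !mxE.
have -> : (fun y : 'cV[R]_m => derive (total_cost f) y (delta_mx j 0)) =
    (fun y => derive1 (f j) (y j 0)).
  apply/funext => y.
  rewrite (@derive_val _ _ _ _ _ _ _ (is_derive_total_cost _ _)).
  rewrite (bigD1 j)//= big1 => [|k /negPf kj]; rewrite mxE ?kj ?mulr0//.
  by rewrite !eqxx mulr1 addr0.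
rewrite (@derive_val _ _ _ _ _ _ _ (is_derive_coord _ _)); last exact: ddf.
rewrite mxE eqxx andbT eq_sym; have [->|] := eqVneq i j; first by rewrite mulr1.
by rewrite mulr0.
Qed.

Lemma continuous_total_cost : continuous (total_cost f : 'cV[R]_m -> R).
Proof.
apply: continuous_big => [|e _ x]; first exact: add_continuous.
apply: (cvg_comp (fun x : 'cV[R]_m => x e 0) (f e)).
  exact: coord_continuous.
have /derivable1_diffP/differentiable_continuous := @df e (x e 0); exact.
Qed.

End total_cost_calculus.

(** * Optimal flows and their potentials *)

Section optimal_flow.
Variables (R : realType) (n m : nat) (src tgt : 'I_m -> 'I_n).
Variable f : 'I_m -> R -> R.
Hypothesis cvx : forall e, strongly_convex (f e).
Hypothesis df : forall e x, derivable (f e) x 1.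

Local Notation A := (incidence src tgt R).
Local Notation S := (mx_image A).
Local Notation xs := (xstar src tgt f).
Local Notation cost := (total_cost f).

(** In the tangent bound at 0 the quadratic term is at most [(|c - g 0| + |s|) * |x|] once
    [|x| > 1]; divide by [|x|]. The summand 1 covers small [x]. *)
Lemma strongly_convex_sublevel (g : R -> R) (c : R) :
  strongly_convex g -> (forall x, derivable g x 1) ->
  exists B : R, forall x, g x <= c -> `|x| <= B.
Proof.
move=> cg dg; have [mu mu0 tg] := strongly_convex_tangent cg dg.
pose s := derive1 g 0.
exists (1 + (`|c - g 0| + `|s|) * 2 / mu) => x gx; have := tg 0 x.
rewrite subr0 -/s => h; have [x1|x1] := leP `|x| 1.
  by rewrite ler_wpDr// !mulr_ge0// ?addr_ge0// invr_ge0 ltW.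
have x0 : 0 < `|x| by exact: lt_trans x1.
have h1 : - (s * x) <= `|s| * `|x| by rewrite -normrM -normrN ler_norm.
have h2 : c - g 0 <= `|c - g 0| * `|x|.
  by rewrite (le_trans (ler_norm _))// ler_peMr// ltW.
rewrite ler_wpDl// ler_pdivlMr//.
suff : mu / 2 * `|x| <= `|c - g 0| + `|s| by lra.
rewrite -(ler_pM2r x0) mulrDl.
have -> : mu / 2 * `|x| * `|x| = mu / 2 * x ^+ 2.
  by rewrite -[X in _ = _ * X]real_normK ?num_real//; ring.
by move: h h1 h2 gx; lra.
Qed.

(** Complete the square in the tangent bound at 0. *)
Lemma strongly_convex_lower_bound (g : R -> R) :
  strongly_convex g -> (forall x, derivable g x 1) ->
  exists B : R, forall x, B <= g x.
Proof.
move=> cg dg; have [mu mu0 tg] := strongly_convex_tangent cg dg.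
pose s := derive1 g 0; exists (g 0 - s ^+ 2 / (2 * mu)) => x.
apply: le_trans (tg 0 x); rewrite subr0 -/s -subr_ge0.
have -> : g 0 + s * x + mu / 2 * x ^+ 2 - (g 0 - s ^+ 2 / (2 * mu)) =
    (mu * x + s) ^+ 2 / (2 * mu) by field; rewrite gt_eqF.
by rewrite divr_ge0 ?sqr_ge0// mulr_ge0// ltW.
Qed.

(** Extreme value theorem on the feasible flows costing at most [cost x0]. This set is bounded: the
    lower bounds [lb] of the other edges bound each [f e] above, hence each coordinate. *)
Lemma optimal_flow_exists b : S b -> exists x, is_optimal_flow src tgt f b x.
Proof.
move=> [x0 bE].
have /choice[lb lbP] e : exists B : R, forall x, B <= f e x.
  exact: strongly_convex_lower_bound (cvx e) (@df e).
have /choice[B BP] e := strongly_convex_sublevel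
  (cost x0 - \sum_(e' | e' != e) lb e') (cvx e) (@df e).
pose G (v : 'rV[R]_m) := cost v^T.
(* Feasibility as a norm at most 0 makes [K] an intersection of preimages of closed half-lines. *)
pose K := [set v : 'rV[R]_m | `|A *m v^T - b| <= 0] `&`
  [set v | G v <= cost x0].
have cT : continuous (fun v : 'rV[R]_m => v^T).
  move=> v; apply/(cvg_mxP (FF := nbhs_filter v)) => i j; rewrite mxE.
  under eq_fun do rewrite mxE.
  exact: coord_continuous.
have cG : continuous G.
  move=> v; apply: (cvg_comp (fun v : 'rV[R]_m => v^T) cost); first exact: cT.
  exact: continuous_total_cost.
have cA (v : 'rV[R]_m) : A *m w^T - b @[w --> v] --> A *m v^T - b.
  apply: (cvgB (FF := nbhs_filter v)); last exact: cvg_cst.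
  by apply: (cvg_mulmx (FF := nbhs_filter v)); [exact: cvg_cst|exact: cT].
have K0 : K !=set0.
  by exists x0^T; split; rewrite /= /G trmxK// bE subrr normr0.
have cN : continuous (fun v : 'rV[R]_m => `|A *m v^T - b|).
  by move=> v; have /(cvg_norm (FF := nbhs_filter v)) := cA v.
have clK : closed K.
  have /continuous_closedP/(_ _ (@closed_le R 0)) clN := cN.
  have /continuous_closedP/(_ _ (@closed_le R (cost x0))) clG := cG.
  exact: closedI clN clG.
have bK : bounded_set K.
  exists (\sum_e `|B e|); split; first exact: num_real.
  move=> M BM v [_ /= Gv]; apply: mx_norm_le.
    by apply: ltW (le_lt_trans _ BM); exact: sumr_ge0.
  move=> i e; rewrite ord1; apply: ltW (le_lt_trans _ BM).
  rewrite (bigD1 e)//= (@le_trans _ _ `|B e|) ?lerDl ?sumr_ge0//.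
  apply: le_trans (ler_norm _); apply: BP; rewrite lerBrDr.
  apply: le_trans Gv; rewrite /G /total_cost [leRHS](bigD1 e)//= mxE lerD2l.
  by apply: ler_sum => e' _; exact: lbP.
have [v vK vmin] := EVT_min_rV K0 (bounded_closed_compact bK clK)
  (continuous_subspaceT cG).
move: vK; rewrite inE => -[/= Av Gv]; exists v^T; split.
  by apply/eqP; rewrite -subr_eq0 -normr_eq0 eq_le Av normr_ge0.
move=> y Ay; have [yx0|x0y] := leP (cost y) (cost x0).
  have := vmin y^T; rewrite /G trmxK; apply.
  rewrite inE; split; rewrite /= /G trmxK//.
  by rewrite Ay subrr normr0.
exact: le_trans Gv (ltW x0y).
Qed.

Lemma xstarP b : S b -> is_optimal_flow src tgt f b (xs b).
Proof. by move=> /optimal_flow_exists; exact: xgetPex. Qed.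

(* First-order optimality: the gradient is orthogonal to the circulations,
   hence a potential difference. *)
Lemma xstar_potential b : S b -> exists p : 'cV_n, gradient f (xs b) = A^T *m p.
Proof.
move=> /xstarP[Ax xmin]; set x := xs b in Ax xmin *.
have orth (k : 'cV[R]_m) : A *m k = 0 -> (gradient f x)^T *m k = 0.
  move=> Ak; have Dk := is_derive_total_cost df x k.
  have min0 (t : R) : cost (0 *: k + x) <= cost (t *: k + x).
    rewrite scale0r add0r; apply: xmin.
    by rewrite mulmxDr -scalemxAr Ak scaler0 add0r.
  have Dline (t : R) : derivable (fun t : R => cost (t *: k + x)) t 1.
    by have /is_derive_line[] := is_derive_total_cost df (t *: k + x) k.
  (* Fermat's rule on the line through [x] in direction [k], all of whose points are feasible. *)
  have := @derive1_at_min _ (fun t => cost (t *: k + x)) (-1) 1 0.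
  have N11 : -1 <= 1 :> R by rewrite (le_trans (lerN10 _)).
  have in0 : 0 \in `](-1 : R), 1[ by rewrite in_itv/= ltrN10 ltr01.
  move=> /(_ N11 (fun t _ => Dline t) in0 (fun t _ => min0 t))/is_derive_line.
  rewrite scale0r add0r => D0; apply/matrixP => i j; rewrite !ord1 !mxE.
  rewrite -[RHS](@derive_val _ _ _ _ _ _ _ D0) (@derive_val _ _ _ _ _ _ _ Dk).
  by apply: eq_bigr => e _; rewrite !mxE.
(* The columns of [cokermx A] are circulations, so orthogonality to circulations puts the gradient
   in the row space of [A]. *)
have : ((gradient f x)^T <= A)%MS.
  rewrite submxE; apply/eqP/rowP => j; rewrite [RHS]mxE.
  transitivity (((gradient f x)^T *m col j (cokermx A)) 0 0).
    by rewrite !mxE; apply: eq_bigr => e _; rewrite !mxE.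
  by rewrite orth ?mxE// colE mulmxA mulmx_coker mul0mx.
move=> /submxP[p pE]; exists p^T.
by rewrite -trmx_mul -pE trmxK.
Qed.

End optimal_flow.

(** * The derivative of the optimal flow *)

Section flow_derivative.
Variables (R : realType) (n m : nat) (src tgt : 'I_m -> 'I_n).
Variable f : 'I_m -> R -> R.
Hypotheses (simple : simple_digraph src tgt) (conn : connected_graph src tgt).
Hypothesis cvx : forall e, strongly_convex (f e).
Hypothesis C2 : forall e, twice_cont_differentiable (f e).

Local Notation A := (incidence src tgt R).
Local Notation S := (mx_image A).
Local Notation xs := (xstar src tgt f).
Local Notation cost := (total_cost f).
Local Notation sg := (Defs.sigma src tgt f).
Local Notation L b := (wlaplacian src tgt (sg b)).
Local Notation Pi := (const_mx n%:R^-1 : 'M[R]_n).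

Let loopless e : src e != tgt e := simple.1 e.

Let df e x : derivable (f e) x 1.
Proof. by have [] := C2 e. Qed.

Let ddf e x : derivable (derive1 (f e)) x 1.
Proof. by have [] := C2 e. Qed.

Definition curvature (b : 'cV[R]_n) e : R := derive1 (derive1 (f e)) (xs b e 0).

Lemma curvature_gt0 b e : 0 < curvature b e.
Proof. exact: strongly_convex_derive2_gt0. Qed.

Lemma SigmaE b : Sigma src tgt f b = diag_mx (\row_e (curvature b e)^-1).
Proof.
rewrite /Sigma hessian_total_cost//.
set H := diag_mx _; set K := diag_mx _.
have HK : H *m K = 1%:M.
  apply/matrixP => i j; rewrite mul_diag_mx !mxE.
  have [->|] := eqVneq i j; last by rewrite mulr0.
  by rewrite mulfV// gt_eqF// curvature_gt0.
have [uH _] := mulmx1_unit HK.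
by rewrite -[LHS]mulmx1 -HK mulKmx.
Qed.

Lemma sigmaE b e : sg b e = (curvature b e)^-1.
Proof. by rewrite /Defs.sigma SigmaE !mxE eqxx. Qed.

Lemma sigma_gt0 b e : 0 < sg b e.
Proof. by rewrite sigmaE invr_gt0 curvature_gt0. Qed.

Lemma Sigma_diag b : Sigma src tgt f b = diag_mx (\row_e sg b e).
Proof.
by rewrite SigmaE; congr diag_mx; apply/rowP => e; rewrite !mxE sigmaE.
Qed.

Lemma wlaplacian_Sigma b : L b = A *m Sigma src tgt f b *m A^T.
Proof. by rewrite Sigma_diag. Qed.

(** Agrees with [Dmx] on the image of [A], but uses a true inverse, whose continuity in [b] is at
    hand. *)
Definition flow_jacobian (b : 'cV[R]_n) : 'M[R]_(m, n) :=
  Sigma src tgt f b *m A^T *m invmx (L b + Pi).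

Lemma image_ones (y : 'cV[R]_n) : S y -> (const_mx 1 : 'rV_n) *m y = 0.
Proof. by move=> [x ->]; rewrite mulmxA const_mul_incidence// mul0mx. Qed.

(** The Jacobian sends [y] to the electrical flow with conductances [sg b] driven by a potential
    [q]. *)
Lemma flow_jacobian_solve b y : S y ->
  exists2 q : 'cV_n, L b *m q = y &
    flow_jacobian b *m y = Sigma src tgt f b *m (A^T *m q).
Proof.
move=> Sy; exists (invmx (L b + Pi) *m y); last by rewrite !mulmxA.
by apply: wlaplacian_solve (image_ones Sy) => //; exact: sigma_gt0.
Qed.

Lemma incidence_flow_jacobian b y : S y -> A *m (flow_jacobian b *m y) = y.
Proof.
move=> /(flow_jacobian_solve b)[q Lq ->].
by rewrite -[RHS]Lq wlaplacian_Sigma !mulmxA.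
Qed.

Lemma Dmx_flow_jacobian b y : S y ->
  Dmx src tgt f b *m y = flow_jacobian b *m y.
Proof.
move=> /(flow_jacobian_solve b)[q Lq ->].
have ATL := incidence_trmx_pinv loopless conn (sigma_gt0 b).
by rewrite /Dmx laplacianE// -Lq -[in RHS]ATL !mulmxA.
Qed.

Lemma image_sub y y' : S y -> S y' -> S (y - y').
Proof. by move=> [x ->] [x' ->]; exists (x - x'); rewrite mulmxBr. Qed.

(* Comparing the cost of the optimal flow for b' with that of the feasible flow
   xs b + J (b' - b): both differ from the first-order expansion at xs b, which
   takes the same value on both, by quadratic terms. *)
Lemma xstar_lipschitz b : S b ->
  exists2 C : R, 0 < C &
    \forall b' \near within S (nbhs b), `|xs b' - xs b| <= C * `|b' - b|.
Proof.
move=> Sb; have [Axb xmin] := xstarP cvx df Sb.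
have [p gp] := xstar_potential cvx df Sb.
set x := xs b in Axb xmin gp *; set J := flow_jacobian b.
have [CJ CJ0 JC] := @mulmx_norm_bound R m n 1 J.
have tangent e : exists mu : R, 0 < mu /\ forall x y,
    f e x + derive1 (f e) x * (y - x) + mu / 2 * (y - x) ^+ 2 <= f e y.
  by have [mu mu0 h] := strongly_convex_tangent (cvx e) (@df e); exists mu.
have {tangent}/choice[mu muP] := tangent.
have taylor e : exists Mr : R * R, [/\ 0 < Mr.1, 0 < Mr.2 &
    forall y, `|x e 0 - y| < Mr.2 ->
      `|f e y - f e (x e 0) - derive1 (f e) (x e 0) * (y - x e 0)| <=
      Mr.1 * (y - x e 0) ^+ 2].
  have [M M0 [r /= r0 h]] := taylor1_bound (@df e) (@ddf e (x e 0)).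
  by exists (M, r).
have {taylor}/choice[Mr MrP] := taylor.
pose M := \sum_e (Mr e).1.
have M0 : 0 <= M by apply: sumr_ge0 => e _; have [/ltW] := MrP e.
pose C0 := \sum_e (2 * M / mu e).
have C00 : 0 <= C0.
  apply: sumr_ge0 => e _; have [mu0 _] := muP e.
  by rewrite divr_ge0 ?mulr_ge0// ltW.
(* [C0] bounds the ratio of [h e 0 ^+ 2] to [|k| ^+ 2], [C0 + 1] bounds its square root, and [CJ]
   passes from [k] to [b' - b]. *)
exists ((C0 + 1) * CJ); first by rewrite mulr_gt0// ltr_wpDl.
near=> b'.
have Sb' : S b' by near: b'; exact: withinT.
have Sd : S (b' - b) by exact: image_sub.
(* Keeps [x + k] within the radius of the Taylor bound on every edge. *)
have small e : CJ * `|b' - b| < (Mr e).2.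
  move: e; near: b'; apply: filter_forall => e; apply: cvg_within.
  have [_ r0 _] := MrP e; near=> y.
  rewrite mulrC -ltr_pdivlMr// distrC; near: y.
  by apply: cvgr_dist_lt; rewrite ?divr_gt0.
set k := J *m (b' - b); set h := xs b' - x.
have [Axb' xmin'] := xstarP cvx df Sb'.
have Ak : A *m k = b' - b by exact: incidence_flow_jacobian.
have Ah : A *m h = b' - b by rewrite mulmxBr Axb' Axb.
(* As the gradient is [A^T *m p], its pairing with [z] depends only on [A *m z]. *)
have gE (z : 'cV[R]_m) :
    \sum_e derive1 (f e) (x e 0) * z e 0 = (p^T *m (A *m z)) 0 0.
  rewrite mulmxA -[p^T *m A]trmxK trmx_mul trmxK -gp mxE.
  by apply: eq_bigr => e _; rewrite !mxE.
have ghk : \sum_e derive1 (f e) (x e 0) * h e 0 =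
    \sum_e derive1 (f e) (x e 0) * k e 0.
  by rewrite !gE Ah Ak.
have cost_le : cost (xs b') <= cost (x + k).
  by apply: xmin'; rewrite mulmxDr Axb Ak addrC subrK.
have lower : cost x + \sum_e derive1 (f e) (x e 0) * h e 0 +
    \sum_e mu e / 2 * h e 0 ^+ 2 <= cost (xs b').
  rewrite /total_cost -!big_split/=; apply: ler_sum => e _.
  by have [_ /(_ (x e 0) (xs b' e 0))] := muP e; rewrite !mxE.
have kle e : `|k e 0| <= `|k| by exact: mx_entry_norm_le.
have upper : cost (x + k) <= cost x + \sum_e derive1 (f e) (x e 0) * k e 0 +
    M * `|k| ^+ 2.
  rewrite /M mulr_suml /total_cost -!big_split/=; apply: ler_sum => e _.
  have [M10 _ /(_ ((x + k) e 0))] := MrP e.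
  rewrite mxE opprD addrA subrr add0r normrN [x e 0 + _ - _]addrAC subrr add0r.
  move=> /(_ (le_lt_trans (le_trans (kle e) (JC _)) (small e))).
  move=> /(le_trans (ler_norm _)) => t1.
  have t2 : (Mr e).1 * k e 0 ^+ 2 <= (Mr e).1 * `|k| ^+ 2.
    by rewrite ler_wpM2l ?(ltW M10)// -real_normK ?num_real// ler_sqr ?nnegrE.
  by move: t1 t2; lra.
have sum_le : \sum_e mu e / 2 * h e 0 ^+ 2 <= M * `|k| ^+ 2.
  by move: lower upper cost_le; rewrite ghk; lra.
have hk : `|h| <= (C0 + 1) * `|k|.
  apply: mx_norm_le => [|e j]; first by rewrite mulr_ge0// addr_ge0.
  rewrite ord1 -ler_sqr ?nnegrE ?mulr_ge0 ?addr_ge0// real_normK ?num_real//.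
  have [mue _] := muP e.
  have h1 : mu e / 2 * h e 0 ^+ 2 <= M * `|k| ^+ 2.
    apply: le_trans sum_le; rewrite (bigD1 e)//= lerDl; apply: sumr_ge0 => i _.
    by have [/ltW mui _] := muP i; rewrite mulr_ge0 ?sqr_ge0// divr_ge0.
  have h2 : h e 0 ^+ 2 <= 2 * M / mu e * `|k| ^+ 2.
    rewrite -(ler_pM2l (x := mu e / 2)) ?divr_gt0// (le_trans h1)//.
    suff -> : mu e / 2 * (2 * M / mu e * `|k| ^+ 2) = M * `|k| ^+ 2 by [].
    by field; rewrite gt_eqF.
  have h3 : 2 * M / mu e <= C0.
    rewrite /C0 (bigD1 e)//= lerDl; apply: sumr_ge0 => i _.
    by have [/ltW mui _] := muP i; rewrite divr_ge0 ?mulr_ge0.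
  apply: (le_trans h2); rewrite exprMn ler_wpM2r ?sqr_ge0//.
  apply: (le_trans h3); rewrite sqrrD mulr1 expr1n -subr_ge0.
  have -> : C0 ^+ 2 + C0 *+ 2 + 1 - C0 = C0 ^+ 2 + C0 + 1 by ring.
  by rewrite !addr_ge0// sqr_ge0.
apply: (le_trans hk); rewrite -mulrA ler_wpM2l ?addr_ge0//; exact: JC.
Unshelve. all: by end_near. Qed.

(* With g the gradient of the cost and H its Hessian at xs b, the remainder
   r = g (xs b') - g (xs b) - H h of h = xs b' - xs b satisfies
   H h + r = A^T q; eliminating q with A h = b' - b expresses
   h - J (b' - b) through r. *)
Lemma xstar_remainder b : S b ->
  exists K : 'M[R]_m, forall b', S b' ->
    xs b' - xs b - flow_jacobian b *m (b' - b) =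
    K *m (\col_e (derive1 (f e) (xs b' e 0) - derive1 (f e) (xs b e 0)
                  - curvature b e * (xs b' e 0 - xs b e 0))).
Proof.
move=> Sb; set Sg := Sigma src tgt f b; set J := flow_jacobian b.
(* From [h = Sg *m (A^T *m q - r)] and [b' - b = L b *m q - A *m (Sg *m r)], the terms in [q] cancel
   by [Jlap]. *)
exists (J *m A *m Sg - Sg) => b' Sb'; set r := \col_e _.
have [p gp] := xstar_potential cvx df Sb.
have [p' gp'] := xstar_potential cvx df Sb'.
have [Axb _] := xstarP cvx df Sb; have [Axb' _] := xstarP cvx df Sb'.
pose q := p' - p; set h := xs b' - xs b.
have hE : h = Sg *m (A^T *m q - r).
  rewrite /q (mulmxBr A^T) -gp -gp'; apply/colP => e.
  rewrite /Sg SigmaE mul_diag_mx !mxE.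
  by field; rewrite gt_eqF// curvature_gt0.
have Ah : A *m h = b' - b by rewrite mulmxBr Axb' Axb.
have AhE : b' - b = L b *m q - A *m (Sg *m r).
  by rewrite -Ah hE !mulmxBr wlaplacian_Sigma !mulmxA.
(* The potential [z'] found for [L b *m z] may differ from [z], but [L b] maps both to the same
   vector, so their edge differences agree. *)
have Jlap (z : 'cV[R]_n) : J *m (L b *m z) = Sg *m (A^T *m z).
  have Sz : S (L b *m z).
    by exists (diag_mx (\row_e sg b e) *m (A^T *m z)); rewrite !mulmxA.
  have [z' Lz ->] := flow_jacobian_solve b Sz; congr (_ *m _).
  apply/eqP; rewrite -subr_eq0 -mulmxBr; apply/eqP.
  apply: (wlaplacian_ker (s := sg b)) => //; first exact: sigma_gt0.
  by rewrite mulmxBr Lz subrr.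
clearbody q h; rewrite AhE !mulmxBr Jlap hE !mulmxBr mulmxBl.
rewrite -!(mulmxA J) -!(mulmxA A); move: (J *m _) => y.
by rewrite opprB addrC addrA subrK.
Qed.

(** The remainder in [xstar_remainder] is small relative to [xs b' - xs b] by differentiability of
    each [derive1 (f e)], and [xstar_lipschitz] compares the latter with [b' - b]. *)
Lemma xstar_frechet b : S b -> forall eps : R, 0 < eps ->
  \forall b' \near within S (nbhs b),
    `|xs b' - xs b - flow_jacobian b *m (b' - b)| <= eps * `|b' - b|.
Proof.
move=> Sb eps eps0; have [C C0 lip] := xstar_lipschitz Sb.
have [K KE] := xstar_remainder Sb.
have [CK CK0 KC] := @mulmx_norm_bound R m m 1 K.
pose e1 := eps / CK / C.
have e10 : 0 < e1 by rewrite !divr_gt0.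
have lin e : exists r : R, 0 < r /\ forall y, `|xs b e 0 - y| < r ->
    `|derive1 (f e) y - derive1 (f e) (xs b e 0) -
      curvature b e * (y - xs b e 0)| <= e1 * `|y - xs b e 0|.
  have := derivableP (@ddf e (xs b e 0)).
  rewrite -derive1E => /is_derive1_nearP/(_ _ e10)[r /= r0 H].
  exists r; split=> // y /H.
  by rewrite /GRing.scale/= mulrC.
have {lin}/choice[r rP] := lin.
near=> b'.
have Sb' : S b' by near: b'; exact: withinT.
have lipb' : `|xs b' - xs b| <= C * `|b' - b| by near: b'.
have small e : C * `|b' - b| < r e.
  move: e; near: b'; apply: filter_forall => e; apply: cvg_within.
  have [r0 _] := rP e; near=> y.
  rewrite mulrC -ltr_pdivlMr// distrC; near: y.
  by apply: cvgr_dist_lt; rewrite ?divr_gt0.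
rewrite KE//; apply: (le_trans (KC _)).
apply: (@le_trans _ _ (CK * (e1 * (C * `|b' - b|)))); last first.
  suff -> : CK * (e1 * (C * `|b' - b|)) = eps * `|b' - b| by [].
  by rewrite /e1; field; rewrite !gt_eqF.
rewrite ler_pM2l//; apply: mx_norm_le => [|e j].
  by apply: mulr_ge0; [exact: ltW|apply: mulr_ge0 => //; exact: ltW].
have xle : `|xs b' e 0 - xs b e 0| <= C * `|b' - b|.
  apply: le_trans lipb'; have := mx_entry_norm_le (xs b' - xs b) e 0.
  by rewrite !mxE.
rewrite mxE; have [_ h] := rP e; apply: (le_trans (h _ _)).
  by rewrite distrC (le_lt_trans xle).
by rewrite ler_pM2l.
Unshelve. all: by end_near. Qed.

Lemma xstar_within_cvg b : S b -> xs b' @[b' --> within S (nbhs b)] --> xs b.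
Proof.
move=> Sb; have [C C0 lip] := xstar_lipschitz Sb.
apply/cvgrPdist_lt => eps eps0; near=> b'.
rewrite distrC; apply: (@le_lt_trans _ _ (C * `|b' - b|)); first by near: b'.
near: b'; apply: cvg_within; near=> y.
rewrite mulrC -ltr_pdivlMr// distrC; near: y.
by apply: cvgr_dist_lt; rewrite ?divr_gt0.
Unshelve. all: by end_near. Qed.

(** Continuity passes from [xs] to the second derivatives, to [Sigma], and through the inverse of
    the invertible [L b + Pi]. *)
Lemma flow_jacobian_continuous : {within S, continuous flow_jacobian}.
Proof.
apply/subspace_continuousP => b Sb.
have sgc e : sg b' e @[b' --> within S (nbhs b)] --> sg b e.
  rewrite sigmaE; under eq_fun do rewrite sigmaE.
  apply: cvgV; first by rewrite gt_eqF// curvature_gt0.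
  have [_ _ /(_ (xs b e 0)) c2] := C2 e.
  apply: (cvg_comp (fun b' => xs b' e 0) (derive1 (derive1 (f e)))).
    2: exact: c2.
  by have /cvg_mxP := xstar_within_cvg Sb; apply.
have Sgc : Sigma src tgt f b' @[b' --> within S (nbhs b)] --> Sigma src tgt f b.
  apply/cvg_mxP => i j.
  rewrite [X in X @ _](_ : _ = (fun b' => sg b' i *+ (i == j))); last first.
    by apply/funext => b'; rewrite Sigma_diag !mxE.
  by rewrite Sigma_diag !mxE; apply: cvgMn; exact: sgc.
apply: cvg_mulmx; first by apply: cvg_mulmx => //; exact: cvg_cst.
apply: cvg_invmx.
  by apply: wlaplacian_shift_unit => // e; exact: sigma_gt0.
apply: cvgD; last exact: cvg_cst.
rewrite wlaplacian_Sigma.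
rewrite [X in X @ _](_ : _ = (fun b' => A *m Sigma src tgt f b' *m A^T)).
  by apply: cvg_mulmx; [apply: cvg_mulmx => //|]; exact: cvg_cst.
by apply/funext => b'; exact: wlaplacian_Sigma.
Qed.

End flow_derivative.

(** * Derivatives of curves of matrices *)

Section matrix_curves.
Variable R : realType.

Lemma is_derive_entry p q (M : R -> 'M[R]_(p, q)) dM (x : R) i j :
  is_derive x 1 M dM -> is_derive x 1 (fun t => M t i j) (dM i j).
Proof.
move=> /is_derive1_nearP D; apply/is_derive1_nearP => e e0.
apply: filterS (D e e0) => t; apply: le_trans.
have := mx_entry_norm_le (M t - M x - (t - x) *: dM) i j.
by rewrite !mxE.
Qed.

Lemma is_derive_mulmx p q r (N : 'M[R]_(p, q)) (M : R -> 'M[R]_(q, r)) dM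
    (x : R) :
  is_derive x 1 M dM -> is_derive x 1 (fun t => N *m M t) (N *m dM).
Proof.
have [C C0 NC] := @mulmx_norm_bound R p q r N.
move=> /is_derive1_nearP D; apply/is_derive1_nearP => e e0.
have eC : 0 < e / C by rewrite divr_gt0.
apply: filterS (D _ eC) => t h; rewrite scalemxAr -!mulmxBr.
apply: le_trans (NC _) _; rewrite -ler_pdivlMl// mulrA [_ * e]mulrC.
exact: h.
Qed.

(** Chain rule for [F] differentiable only within [S]: the curve stays in [S], so the relative
    estimate applies along it. *)
Lemma is_derive_comp_within p q (S : set 'cV[R]_p) (F : 'cV[R]_p -> 'cV[R]_q)
    (J : 'M[R]_(q, p)) (b : R -> 'cV[R]_p) db (x : R) :
  (forall eps : R, 0 < eps -> \forall y \near within S (nbhs (b x)),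
     `|F y - F (b x) - J *m (y - b x)| <= eps * `|y - b x|) ->
  (forall t, S (b t)) -> is_derive x 1 b db ->
  is_derive x 1 (fun t => F (b t)) (J *m db).
Proof.
move=> DF Sb Db.
have /derivable1_diffP/differentiable_continuous cb : derivable b x 1.
  by case: Db.
have /is_derive1_nearP DJ := is_derive_mulmx J Db.
move: Db => /is_derive1_nearP Db; apply/is_derive1_nearP => e e0.
(* Near [x] the increment of [b] is at most [|db| + 1] times [|t - x|], so the error of [F] takes
   half of [e]. *)
pose e1 := e / 2 / (`|db| + 1).
have db0 : 0 < `|db| + 1 by rewrite ltr_wpDl.
have e10 : 0 < e1 by rewrite !divr_gt0.
have e20 : 0 < e / 2 by rewrite divr_gt0.
have {}DF : \forall t \near x, S (b t) ->
    `|F (b t) - F (b x) - J *m (b t - b x)| <= e1 * `|b t - b x|.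
  exact: cb _ (DF _ e10).
near=> t.
have h1 : `|F (b t) - F (b x) - J *m (b t - b x)| <= e1 * `|b t - b x|.
  by have := Sb t; near: t.
have h2 : `|J *m b t - J *m b x - (t - x) *: (J *m db)| <= e / 2 * `|t - x|.
  by near: t; exact: DJ.
have h3 : `|b t - b x - (t - x) *: db| <= 1 * `|t - x| by near: t; exact: Db.
have h4 : `|b t - b x| <= (`|db| + 1) * `|t - x|.
  rewrite -[b t - b x](subrK ((t - x) *: db)) (le_trans (ler_normD _ _))//.
  by rewrite mulrDl addrC lerD// normrZ mulrC.
have -> : F (b t) - F (b x) - (t - x) *: (J *m db) =
    (F (b t) - F (b x) - J *m (b t - b x)) +
    (J *m b t - J *m b x - (t - x) *: (J *m db)).
  by rewrite mulmxBr addrA subrK.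
rewrite (le_trans (ler_normD _ _))// [e in leRHS]splitr mulrDl lerD//.
apply: (le_trans h1); apply: (@le_trans _ _ (e1 * ((`|db| + 1) * `|t - x|))).
  by rewrite ler_pM2l.
suff -> : e1 * ((`|db| + 1) * `|t - x|) = e / 2 * `|t - x| by [].
by rewrite /e1; field; rewrite gt_eqF.
Unshelve. all: by end_near. Qed.

End matrix_curves.

(** The walk formula appears with ordinary sums on nonbipartite graphs and with limits of means on
    all graphs. The convergence claims ensure that each [limn] is a genuine limit. *)
Theorem theorem3 (R : realType) (n m : nat) (src tgt : 'I_m -> 'I_n)
    (f : 'I_m -> R -> R) :
  simple_digraph src tgt ->
  connected_graph src tgt ->
  (forall e, strongly_convex (f e)) ->
  (forall e, twice_cont_differentiable (f e)) ->
  C1_along (mx_image (incidence src tgt R)) (xstar src tgt f) /\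
  forall b : R -> 'cV[R]_n,
    (forall t, mx_image (incidence src tgt R) (b t)) ->
    (forall t, derivable b t 1) ->
    forall eps : R,
      is_derive eps 1 (fun t => xstar src tgt f (b t))
        (Dmx src tgt f (b eps) *m derive1 b eps) /\
      forall e : 'I_m,
        (~ bipartite_graph src tgt ->
          (forall z, cvgn (series (walk_diff src tgt f (b eps) e z))) /\
          is_derive eps 1 (fun t => xstar src tgt f (b t) e 0)
            (sigma src tgt f (b eps) e *
             \sum_z (degree src tgt f (b eps) 0 z)^-1 * derive1 b eps z 0 *
               limn (series (walk_diff src tgt f (b eps) e z)))) /\
        (forall z, cvgn (cesaro_means (walk_diff src tgt f (b eps) e z))) /\
        is_derive eps 1 (fun t => xstar src tgt f (b t) e 0)
          (sigma src tgt f (b eps) e *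
           \sum_z (degree src tgt f (b eps) 0 z)^-1 * derive1 b eps z 0 *
             limn (cesaro_means (walk_diff src tgt f (b eps) e z))).
Proof.
move=> simple conn cvx C2; split.
  exists (flow_jacobian src tgt f); split; last exact: flow_jacobian_continuous.
  by move=> b Sb eps eps0; exact: xstar_frechet.
move=> b Sb db eps; set A := incidence src tgt R.
have Db : is_derive eps 1 b (derive1 b eps).
  by rewrite derive1E; exact: derivableP.
set b' := derive1 b eps in Db *.
(* Differentiating the identity [A *m (J *m b t) = b t], with [J] the Jacobian at [b eps], exhibits
   a preimage of [b']. *)
have Sb' : mx_image A b'.
  exists (flow_jacobian src tgt f (b eps) *m b').
  have D1 := is_derive_mulmx A
    (is_derive_mulmx (flow_jacobian src tgt f (b eps)) Db).
  have E : (fun t => A *m (flow_jacobian src tgt f (b eps) *m b t)) = b.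
    by apply/funext => t; exact: incidence_flow_jacobian.
  rewrite E in D1.
  rewrite -[LHS](@derive_val _ _ _ _ _ _ _ Db).
  exact: (@derive_val _ _ _ _ _ _ _ D1).
have Dx : is_derive eps 1 (fun t => xstar src tgt f (b t))
    (Dmx src tgt f (b eps) *m b').
  rewrite Dmx_flow_jacobian//; apply: (is_derive_comp_within _ Sb Db).
  by move=> e e0; exact: xstar_frechet.
split=> // e; have m0 : (0 < m)%N := leq_ltn_trans (leq0n e) (ltn_ord e).
have s0 := sigma_gt0 src tgt cvx C2 (b eps).
pose F := fundamental src tgt (Defs.sigma src tgt f (b eps)).
(* With [L *m q = b'], the entry is [sigma] times the potential difference of [q] along [e], which
   [edge_flow_formula] expresses through the sum [A^T *m F] of the walk series. *)
have flowE : (Dmx src tgt f (b eps) *m b') e 0 =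
    Defs.sigma src tgt f (b eps) e *
    \sum_z (degree src tgt f (b eps) 0 z)^-1 * b' z 0 * (A^T *m F) e z.
  rewrite Dmx_flow_jacobian//.
  have [q Lq ->] := flow_jacobian_solve simple conn cvx C2 (b eps) Sb'.
  rewrite Sigma_diag// mul_diag_mx !mxE; congr (_ * _).
  rewrite degreeE// (edge_flow_formula simple conn s0 m0 e Lq).
  by rewrite mxE.
have Dxe := is_derive_entry e 0 Dx.
have ces z :
    cesaro_means (walk_diff src tgt f (b eps) e z) @ \oo --> (A^T *m F) e z.
  by rewrite walk_diffE//; exact: cesaro_walk_diff_cvg.
split=> [nbip|]; last first.
  split=> [z|]; first by apply/cvg_ex; exists ((A^T *m F) e z).
  apply: is_derive_eq Dxe _; rewrite flowE; congr (_ * _).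
  by apply: eq_bigr => z _; rewrite (cvg_lim _ (ces z)).
have ser z : series (walk_diff src tgt f (b eps) e z) @ \oo --> (A^T *m F) e z.
  by rewrite walk_diffE//; exact: series_walk_diff_cvg.
split=> [z|]; first by apply/cvg_ex; exists ((A^T *m F) e z).
apply: is_derive_eq Dxe _; rewrite flowE; congr (_ * _).
by apply: eq_bigr => z _; rewrite (cvg_lim _ (ser z)).
Qed.
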